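(* Let $M$ be an oriented matroid on a (finite) linearly ordered set $E$. Then, as an identity of polynomials in the indeterminates $x,u,y,v$, $$t(M;x+u,y+v)=\sum_{A\subseteq E} x^{\theta^*_M(A)}\,u^{\overline{\theta}^*_M(A)}\,y^{\theta_M(A)}\,v^{\overline{\theta}_M(A)},$$ where $t(M;x,y)$ denotes the Tutte polynomial of (the underlying matroid of) $M$.
   Context: The Tutte polynomial of a matroid $M$ on $E$ is $t(M;x,y)=\sum_{A\subseteq E}(x-1)^{r(M)-r_M(A)}(y-1)^{|A|-r_M(A)}$, where $r_M(A)$ is the rank of $A$ in $M$ and $r(M)=r_M(E)$; for an oriented matroid one uses the underlying matroid. Let $M$ be an oriented matroid on a finite linearly ordered set $E$. A positive circuit (resp. cocircuit) is a signed circuit (resp. cocircuit) $X=(X^+,X^-)$ with $X^-=\emptyset$. $O(M)$ is the set of elements of $E$ that are the smallest element of some positive circuit of $M$ (orientation active elements), and $O^*(M)=O(M^* )$ is the set of elements of $E$ that are the smallest element of some positive cocircuit of $M$ (orientation dually-active elements). For $A\subseteq E$, $-_AM$ denotes the oriented matroid obtained from $M$ by reorientation on $A$ (the signs of the elements of $A$ are reversed in all signed circuits and cocircuits). The four $\theta$-activities of $A\subseteq E$ are $$\theta_M(A)=|O(-_AM)\setminus A|,\quad \overline{\theta}_M(A)=|O(-_AM)\cap A|,$$ $$\theta^*_M(A)=|O^*(-_AM)\setminus A|,\quad \overline{\theta}^*_M(A)=|O^*(-_AM)\cap A|.$$ *)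

(* Defs.v *)
From mathcomp Require Import all_boot all_order all_algebra.
From mathcomp Require Import mpoly.

Set Implicit Arguments.
Unset Strict Implicit.
Unset Printing Implicit Defensive.

Import Order.TTheory GRing.Theory.
Local Open Scope ring_scope.

Record matroid (E : finType) := Matroid {
  mcircuits : {set {set E}};
  mcircuit_neq0 : set0 \notin mcircuits;
  mcircuit_incl : forall C D : {set E},
    C \in mcircuits -> D \in mcircuits -> C \subset D -> C = D;
  mcircuit_elim : forall (C D : {set E}) (e : E),
    C \in mcircuits -> D \in mcircuits -> C != D -> e \in C :&: D ->
    exists2 Z : {set E}, Z \in mcircuits & Z \subset (C :|: D) :\ e }.

Definition independent (E : finType) (N : matroid E) (I : {set E}) : bool :=
  [forall C in mcircuits N, ~~ (C \subset I)].

Definition mrank (E : finType) (N : matroid E) (A : {set E}) : nat :=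
  \max_(I : {set E} | (I \subset A) && independent N I) #|I|.

Definition mbasis (E : finType) (N : matroid E) (B : {set E}) : bool :=
  maxset (independent N) B.

(* The bases of the dual matroid are the complements of the bases of N, so a
   set is dependent in the dual exactly when it meets every basis of N. *)
Definition mcocircuit (E : finType) (N : matroid E) (D : {set E}) : bool :=
  minset (fun D' : {set E} => [forall B, mbasis N B ==> (D' :&: B != set0)]) D.

(* 'X_0 and 'X_1 play the roles of x and y in t(N; x, y). *)
Definition tutte (E : finType) (N : matroid E) : {mpoly int[2]} :=
  \sum_(A : {set E})
    ('X_(@Ordinal 2 0 isT) - 1) ^+ (mrank N [set: E] - mrank N A)
    * ('X_(@Ordinal 2 1 isT) - 1) ^+ (#|A| - mrank N A).

(* The signed set (X^+, X^-); disjointness of the two parts is imposed where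
   signed circuits and cocircuits are defined. *)
Notation signed_set E := ({set E} * {set E})%type.

Definition sopp (E : finType) (X : signed_set E) : signed_set E := (X.2, X.1).

Definition supp (E : finType) (X : signed_set E) : {set E} := X.1 :|: X.2.

Definition spositive (E : finType) (X : signed_set E) : bool := X.2 == set0.

Record oriented_matroid (E : finType) := OrientedMatroid {
  circuits : {set signed_set E};
  circuit_disjoint : forall X, X \in circuits -> [disjoint X.1 & X.2];
  circuit_neq0 : forall X, X \in circuits -> supp X != set0;
  circuit_opp : forall X, X \in circuits -> sopp X \in circuits;
  circuit_incl : forall X Y, X \in circuits -> Y \in circuits ->
    supp X \subset supp Y -> X = Y \/ X = sopp Y;
  circuit_elim : forall X Y (e : E), X \in circuits -> Y \in circuits ->
    X <> sopp Y -> e \in X.1 :&: Y.2 ->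
    exists2 Z, Z \in circuits &
      (Z.1 \subset (X.1 :|: Y.1) :\ e) && (Z.2 \subset (X.2 :|: Y.2) :\ e) }.

Lemma supp_sopp (E : finType) (X : signed_set E) : supp (sopp X) = supp X.
Proof. by rewrite /supp setUC. Qed.

Lemma soppK (E : finType) (X : signed_set E) : sopp (sopp X) = X.
Proof. by case: X. Qed.

Lemma underlying_neq0 (E : finType) (M : oriented_matroid E) :
  set0 \notin @supp E @: circuits M.
Proof. by apply/imsetP => -[X /circuit_neq0 /eqP X0 /esym]. Qed.

Lemma underlying_incl (E : finType) (M : oriented_matroid E) (C D : {set E}) :
  C \in @supp E @: circuits M -> D \in @supp E @: circuits M ->
  C \subset D -> C = D.
Proof.
move=> /imsetP[X XM ->] /imsetP[Y YM ->] sXY.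
by case: (circuit_incl XM YM sXY) => ->; rewrite ?supp_sopp.
Qed.

Lemma underlying_elim (E : finType) (M : oriented_matroid E) (C D : {set E})
    (e : E) :
  C \in @supp E @: circuits M -> D \in @supp E @: circuits M ->
  C != D -> e \in C :&: D ->
  exists2 Z : {set E}, Z \in @supp E @: circuits M & Z \subset (C :|: D) :\ e.
Proof.
have wit X Y : X \in circuits M -> Y \in circuits M -> supp X != supp Y ->
    e \in X.1 -> e \in Y.2 -> exists2 Z : {set E},
    Z \in @supp E @: circuits M & Z \subset (supp X :|: supp Y) :\ e.
  move=> XM YM nXY eX eY; case: (circuit_elim (e := e) XM YM).
  - by move=> XY; rewrite XY supp_sopp eqxx in nXY.
  - by rewrite inE eX.
  move=> Z ZM /andP[Z1 Z2]; exists (supp Z); first exact: imset_f.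
  rewrite subUset (subset_trans Z1) ?(subset_trans Z2) //;
  by apply: setSD; rewrite setUACA ?subsetUl ?subsetUr.
move=> /imsetP[X XM ->] /imsetP[Y YM ->] nXY.
rewrite !inE => /andP[/orP[] eX /orP[] eY].
- by rewrite -(supp_sopp Y); apply: wit; rewrite ?supp_sopp ?circuit_opp.
- exact: wit.
- rewrite -(supp_sopp Y) -(supp_sopp X).
  by apply: wit; rewrite ?supp_sopp ?circuit_opp.
- by rewrite -(supp_sopp X); apply: wit; rewrite ?supp_sopp ?circuit_opp.
Qed.

Definition underlying (E : finType) (M : oriented_matroid E) : matroid E :=
  Matroid (underlying_neq0 M) (@underlying_incl E M) (@underlying_elim E M).

Definition sorthogonal (E : finType) (X Y : signed_set E) : bool :=
  [disjoint supp X & supp Y]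
  || ((X.1 :&: Y.1) :|: (X.2 :&: Y.2) != set0)
     && ((X.1 :&: Y.2) :|: (X.2 :&: Y.1) != set0).

(* The signed circuits of the dual oriented matroid: the signatures of the
   cocircuits of the underlying matroid orthogonal to all signed circuits. *)
Definition cocircuits (E : finType) (M : oriented_matroid E) :
    {set signed_set E} :=
  [set Y : signed_set E | [&& [disjoint Y.1 & Y.2],
    mcocircuit (underlying M) (supp Y)
    & [forall X in circuits M, sorthogonal X Y]]].

Definition reorient_set (E : finType) (A : {set E}) (X : signed_set E) :
    signed_set E :=
  ((X.1 :\: A) :|: (X.2 :&: A), (X.2 :\: A) :|: (X.1 :&: A)).

Lemma reorient_setK (E : finType) (A : {set E}) :
  involutive (reorient_set A).
Proof.
by case=> P N; congr pair; apply/setP => e; rewrite !inE;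
  case: (e \in A); case: (e \in P); case: (e \in N).
Qed.

Lemma supp_reorient (E : finType) (A : {set E}) (X : signed_set E) :
  supp (reorient_set A X) = supp X.
Proof.
by apply/setP => e; rewrite !inE;
  case: (e \in A); case: (e \in X.1); case: (e \in X.2).
Qed.

Lemma mem_reorient (E : finType) (A : {set E}) (S : {set signed_set E}) X :
  (X \in reorient_set A @: S) = (reorient_set A X \in S).
Proof.
rewrite -{1}(reorient_setK A X) mem_imset //.
exact: inv_inj (reorient_setK A).
Qed.

Lemma reorient_disjoint (E : finType) (M : oriented_matroid E) A X :
  X \in reorient_set A @: circuits M -> [disjoint X.1 & X.2].
Proof.
rewrite mem_reorient => /circuit_disjoint; rewrite -!setI_eq0 => /eqP dX.
apply/eqP/setP => e; have := congr1 (fun S : {set E} => e \in S) dX.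
by rewrite !inE; case: (e \in A); case: (e \in X.1); case: (e \in X.2).
Qed.

Lemma reorient_neq0 (E : finType) (M : oriented_matroid E) A X :
  X \in reorient_set A @: circuits M -> supp X != set0.
Proof. by rewrite mem_reorient => /circuit_neq0; rewrite supp_reorient. Qed.

Lemma reorient_opp (E : finType) (M : oriented_matroid E) A X :
  X \in reorient_set A @: circuits M -> sopp X \in reorient_set A @: circuits M.
Proof. by rewrite !mem_reorient => /circuit_opp. Qed.

Lemma reorient_incl (E : finType) (M : oriented_matroid E) A X Y :
  X \in reorient_set A @: circuits M -> Y \in reorient_set A @: circuits M ->
  supp X \subset supp Y -> X = Y \/ X = sopp Y.
Proof.
rewrite !mem_reorient -(supp_reorient A X) -(supp_reorient A Y) => XM YM sXY.
have rI := inv_inj (reorient_setK A).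
by case: (circuit_incl XM YM sXY) => XY; [left|right]; apply: rI.
Qed.

Lemma reorient_elim (E : finType) (M : oriented_matroid E) A X Y (e : E) :
  X \in reorient_set A @: circuits M -> Y \in reorient_set A @: circuits M ->
  X <> sopp Y -> e \in X.1 :&: Y.2 ->
  exists2 Z, Z \in reorient_set A @: circuits M &
    (Z.1 \subset (X.1 :|: Y.1) :\ e) && (Z.2 \subset (X.2 :|: Y.2) :\ e).
Proof.
rewrite !mem_reorient => XM YM nXY eXY.
have rI := inv_inj (reorient_setK A).
have conclude Z : Z \in circuits M ->
    (Z.1 \subset ((reorient_set A X).1 :|: (reorient_set A Y).1) :\ e) &&
    (Z.2 \subset ((reorient_set A X).2 :|: (reorient_set A Y).2) :\ e) ->
    exists2 Z, Z \in reorient_set A @: circuits M &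
    (Z.1 \subset (X.1 :|: Y.1) :\ e) && (Z.2 \subset (X.2 :|: Y.2) :\ e).
  move=> ZM /andP[/subsetP Z1 /subsetP Z2]; exists (reorient_set A Z).
    exact: imset_f.
  by apply/andP; split; apply/subsetP => f; have := Z1 f; have := Z2 f;
    rewrite !inE; case: (f \in A); case: (f \in Z.1); case: (f \in Z.2);
    rewrite ?andbT ?andbF ?orbT ?orbF //= => h1 h2 h; auto.
have [eA|eA] := boolP (e \in A).
  have [||Z ZM] := circuit_elim (e := e) YM XM.
  - by move=> YX; apply: nXY; apply: rI; rewrite -[LHS]soppK -YX.
  - by move: eXY; rewrite !inE eA => /andP[-> ->]; rewrite !orbT.
  by rewrite (setUC (reorient_set A Y).1) (setUC (reorient_set A Y).2);
    apply: conclude.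
have [||Z ZM] := circuit_elim (e := e) XM YM; last exact: conclude.
- by move=> XY; apply: nXY; apply: rI; rewrite XY.
by move: eXY; rewrite !inE eA => /andP[-> ->].
Qed.

Definition reorient (E : finType) (A : {set E}) (M : oriented_matroid E) :
    oriented_matroid E :=
  OrientedMatroid (@reorient_disjoint E M A) (@reorient_neq0 E M A)
    (@reorient_opp E M A) (@reorient_incl E M A) (@reorient_elim E M A).

Definition smallest d (E : finOrderType d) (A : {set E}) (e : E) : bool :=
  (e \in A) && [forall f in A, (e <= f)%O].

Definition active d (E : finOrderType d) (M : oriented_matroid E) : {set E} :=
  [set e | [exists X in circuits M, spositive X && smallest (supp X) e]].

Definition dual_active d (E : finOrderType d) (M : oriented_matroid E) :
    {set E} :=
  [set e | [exists Y in cocircuits M, spositive Y && smallest (supp Y) e]].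

Definition theta d (E : finOrderType d) (M : oriented_matroid E)
    (A : {set E}) : nat :=
  #|active (reorient A M) :\: A|.

Definition theta_bar d (E : finOrderType d) (M : oriented_matroid E)
    (A : {set E}) : nat :=
  #|active (reorient A M) :&: A|.

Definition theta_star d (E : finOrderType d) (M : oriented_matroid E)
    (A : {set E}) : nat :=
  #|dual_active (reorient A M) :\: A|.

Definition theta_bar_star d (E : finOrderType d) (M : oriented_matroid E)
    (A : {set E}) : nat :=
  #|dual_active (reorient A M) :&: A|.

(* Main.v *)
Require Import Defs.
From mathcomp Require Import all_boot all_order all_algebra.
From mathcomp Require Import mpoly ring.
Local Open Scope ring_scope.

(** The identity is the deletion-contraction recursion of the Tutte polynomial,
    along the largest element [w]. If [w] is a loop, it is active in both
    orientations of [w], which contributes the factor [y + v]; dually a coloop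
    contributes [x + u]. Otherwise [w] is never active, and the point is that, of the
    two reorientations of [M] that differ only at [w], one has the activities of the
    deletion of [w], and the other one those of the contraction.

    Minors are not constructed: a minor is a pair of disjoint sets, [D] of deleted
    and [C] of contracted elements, and its positive circuits are replaced by the
    circuits of [M] that avoid [D] and are negative only in [C] ([paintable]).
    The painting theorem ([painting]) says that such a circuit through [e] exists
    unless there is a cocircuit through [e] that avoids [C] and is negative only in
    [D]. So activities and dual activities become answers to questions of one kind:
    [e] is active when it is paintable after the smaller elements are deleted, and
    dually active when it is not paintable after they are contracted.

    Contracting [w] leaves its sign free, so an answer in the contraction is the
    disjunction of the answers for the two signs of [w]; by painting, deletion gives
    the conjunction. If the sign of [w] matters to the answer for [e], then the
    witnesses contain [w], and the two answers for [w] to the same question differ in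
    the same way as those for [e] ([paintable_flip]). All the questions that arise
    form a chain in which less and less is deleted and more and more is contracted,
    along which answers for [w] can only turn from no to yes. Hence a change of the
    sign of [w] changes all answers in the same direction ([answers_comparable]), so
    one sign gives all the conjunctions and the other one all the disjunctions.

    The painting theorem is an induction that moves one element at a time to [D] or
    to [C] and uses only the orthogonality of circuits and cocircuits. Its base is
    that each cocircuit of the underlying matroid has a signature orthogonal to all
    signed circuits ([cocircuit_signature]). This is the part that depends on signed
    circuit elimination, which does not keep a given element; instead, one takes
    pairs of circuits with smallest union, to which the strong elimination property
    of the underlying matroid applies. *)

Set Implicit Arguments.
Unset Strict Implicit.
Unset Printing Implicit Defensive.

(** * Rank and cocircuits of a matroid given by its circuits *)

Section MatroidRank.
Local Open Scope nat_scope.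
Variables (E : finType) (N : matroid E).
Implicit Types (A B C D I J K S T X Z : {set E}) (e f g : E).

Lemma independentP I :
  reflect (forall C, C \in mcircuits N -> ~~ (C \subset I)) (independent N I).
Proof. exact: forall_inP. Qed.

Lemma dependentP I :
  reflect (exists2 C, C \in mcircuits N & C \subset I) (~~ independent N I).
Proof.
rewrite negb_forall_in; apply: (iffP exists_inP).
  by case=> C CN; rewrite negbK; exists C.
by case=> C CN CI; exists C; rewrite ?negbK.
Qed.

Lemma independent_sub I J : I \subset J -> independent N J -> independent N I.
Proof.
move=> sIJ /independentP iJ; apply/independentP => C CN.
by apply: contra (iJ C CN) => /subset_trans; apply.
Qed.

Lemma independent0 : independent N set0.
Proof.
apply/independentP => C CN; rewrite subset0.
by apply: contraTneq CN => ->; apply: mcircuit_neq0.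
Qed.

(** Steinitz augmentation. Among the independent sets inside [I :|: J] that are
    larger than [I], take [K] with [I :\: K] smallest. Exchanging [e] in
    [I :\: K] for [g] in [K :\: I] brings [K] closer to [I], hence creates a
    circuit; two such circuits, for different [g], both contain [e], and
    eliminating [e] leaves a circuit inside [K]. *)
Lemma independent_augment I J :
  independent N I -> independent N J -> #|I| < #|J| ->
  exists2 e, e \in J :\: I & independent N (e |: I).
Proof.
move=> iI iJ ltIJ; apply/exists_inP; apply: contraT.
rewrite negb_exists_in => /forall_inP noaug.
pose P K := [&& independent N K, K \subset I :|: J & #|I| < #|K|].
have PJ : P J by rewrite /P iJ subsetUr.
case: (@arg_minnP _ J P (fun K => #|I :\: K|) PJ) => K /and3P[iK sK ltIK] minK.
have [e eI eK] : exists2 e, e \in I & e \notin K.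
  apply/subsetPn; apply/negP => sIK.
  have : I \proper K.
    by rewrite properEcard sIK.
  case/properP=> _ [g gK gI].
  have gJ : g \in J :\: I.
    by rewrite inE gI; move: (subsetP sK g gK); rewrite inE (negPf gI).
  case/negP: (noaug g gJ); apply: independent_sub iK.
  by rewrite subUset sub1set gK.
have circ g : g \in K :\: I -> exists2 C, C \in mcircuits N &
    [&& e \in C, C \subset e |: (K :\ g) & g \notin C].
  rewrite inE => /andP[gI gK].
  have /dependentP[C CN sC] : ~~ independent N (e |: (K :\ g)).
    apply/negP => iT.
    have /minK : P (e |: (K :\ g)).
      rewrite /P iT cardsU1 !inE (negPf eK) andbF /=.
      rewrite (cardsD1 g K) gK in ltIK; rewrite ltIK andbT.
      rewrite subUset sub1set inE eI /=.
      by apply: subset_trans sK; apply: subsetDl.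
    rewrite leqNgt => /negP; apply; apply: proper_card; apply/properP; split.
      apply/subsetP => h; rewrite !inE negb_or => /andP[/andP[he hK] hI].
      rewrite hI andbT; apply: contra hK => hK; rewrite hK andbT.
      by apply: contraNneq gI => <-.
    by exists e; rewrite !inE ?eqxx ?eI ?(negPf eK).
  exists C => //; rewrite sC /= andbC; apply/andP; split.
    apply: contraNN gI => gC; move: (subsetP sC g gC).
    by rewrite !inE eqxx orbF => /eqP ->.
  apply: contraT => eC; move/independentP: iK => /(_ C CN) /negP[].
  apply: subset_trans (subsetDl K [set g]); apply/subsetP => h hC.
  have := subsetP sC h hC; rewrite in_setU1 => /predU1P[he|//].
  by rewrite -he hC in eC.
have [g gK] : exists g, g \in K :\: I.
  apply/set0Pn; apply: contraTneq ltIK => /eqP; rewrite setD_eq0 -leqNgt.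
  exact: subset_leq_card.
have [C CN /and3P[eC sC gC]] := circ g gK.
have [h hC hKI] : exists2 h, h \in C & h \in K :\: I.
  apply/exists_inP; apply: contraT; rewrite negb_exists_in => /forall_inP nC.
  move/independentP: iI => /(_ C CN) /negP[]; apply/subsetP => h hC.
  have := subsetP sC h hC; rewrite !inE => /predU1P[->//|/andP[_ hK]].
  by have := nC h hC; rewrite inE hK andbT negbK.
have [D DN /and3P[eD sD hD]] := circ h hKI.
have CD : C != D by apply: contraNneq hD => <-.
have eCD : e \in C :&: D by rewrite inE eC.
have [Z ZN sZ] := mcircuit_elim CN DN CD eCD.
move/independentP: iK => /(_ Z ZN) /negP[]; apply: subset_trans sZ _.
apply/subsetP => k; rewrite !inE => /andP[/negPf ke /orP[kC|kD]].
  by have := subsetP sC k kC; rewrite !inE ke => /andP[].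
by have := subsetP sD k kD; rewrite !inE ke => /andP[].
Qed.

Lemma card_indep_leq_rank I S :
  independent N I -> I \subset S -> #|I| <= mrank N S.
Proof.
by move=> iI sI; rewrite /mrank (leq_bigmax_cond (P := fun I =>
  (I \subset S) && independent N I)) ?sI.
Qed.

Lemma rank_witness S :
  exists I, [/\ I \subset S, independent N I & #|I| = mrank N S].
Proof.
have P0 : (set0 \subset S) && independent N set0.
  by rewrite sub0set independent0.
rewrite /mrank (bigmax_eq_arg (F := fun I : {set E} => #|I|) _ P0) //.
case: arg_maxnP => // I /andP[sI iI] _; by exists I.
Qed.

Lemma rank_witness_extend I S : independent N I -> I \subset S ->
  exists J, [/\ I \subset J, J \subset S, independent N J & #|J| = mrank N S].
Proof.
move=> iI sI; pose P J := [&& I \subset J, J \subset S & independent N J].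
have PI : P I by rewrite /P subxx sI.
case: (@arg_maxnP _ I P (fun J => #|J|) PI) => J /and3P[sIJ sJ iJ] maxJ.
exists J; split=> //; apply/eqP; rewrite eqn_leq card_indep_leq_rank //=.
rewrite leqNgt; apply/negP; have [K [sK iK <-]] := rank_witness S.
case/(independent_augment iJ iK) => e; rewrite inE => /andP[eJ eK] ieJ.
have : P (e |: J).
  by rewrite /P ieJ (subset_trans sIJ) ?subsetUr // subUset sub1set sJ (subsetP sK).
by move/maxJ; rewrite /= cardsU1 eJ ltnn.
Qed.

Lemma rank_mono S T : S \subset T -> mrank N S <= mrank N T.
Proof.
move=> sST; have [I [sI iI <-]] := rank_witness S.
by rewrite card_indep_leq_rank // (subset_trans sI).
Qed.

Lemma rank0 : mrank N set0 = 0.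
Proof.
have [I [sI _ <-]] := rank_witness set0.
by apply/eqP; rewrite cards_eq0 -subset0.
Qed.

Lemma rank_subadd S T : mrank N (S :|: T) <= #|S| + mrank N T.
Proof.
have [I [sI iI <-]] := rank_witness (S :|: T).
rewrite -(cardsID S I) leq_add ?subset_leq_card ?subsetIr //.
apply: card_indep_leq_rank; first by apply: independent_sub iI; apply: subsetDl.
by rewrite subDset.
Qed.

Definition spans S e : bool :=
  [exists X in mcircuits N, (e \in X) && (X \subset e |: S)].

Lemma spansP S e : reflect
  (exists X, [/\ X \in mcircuits N, e \in X & X \subset e |: S]) (spans S e).
Proof.
apply: (iffP exists_inP) => [[X XN /andP[]]|[X [XN eX sX]]]; exists X => //.
by rewrite eX.
Qed.

Lemma rankU1 S e : e \notin S ->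
  mrank N (e |: S) = mrank N S + ~~ spans S e.
Proof.
move=> eS; have ub : mrank N (e |: S) <= (mrank N S).+1.
  have [I [sI iI <-]] := rank_witness (e |: S).
  have : #|I :\ e| <= mrank N S.
    apply: card_indep_leq_rank; first by apply: independent_sub iI; apply: subsetDl.
    by apply/subsetP => h; rewrite !inE => /andP[he /(subsetP sI)];
      rewrite !inE (negPf he).
  by rewrite (cardsD1 e I); case: (e \in I) => //= /leqW.
have lb : mrank N S <= mrank N (e |: S) by rewrite rank_mono ?subsetUr.
have [/spansP[X [XN eX sX]]|nsp] := boolP (spans S e); last first.
  rewrite addn1; apply/eqP; rewrite eqn_leq ub /=.
  have [I [sI iI <-]] := rank_witness S.
  have -> : #|I|.+1 = #|e |: I|.
    by rewrite cardsU1 (contra (subsetP sI e) eS).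
  apply: card_indep_leq_rank; last exact: setUS.
  apply/independentP => X XN; apply/negP => sX; case/negP: nsp.
  have [eX|eX] := boolP (e \in X).
    by apply/spansP; exists X; split=> //; apply: subset_trans sX (setUS _ sI).
  move/independentP: iI => /(_ X XN) /negP[]; apply/subsetP => h hX.
  have := subsetP sX h hX; rewrite !inE => /predU1P[he|//].
  by rewrite -he hX in eX.
rewrite addn0; apply/eqP; rewrite eqn_leq lb andbT leqNgt; apply/negP => lt.
(* A basis of [S] containing [X :\ e] cannot be augmented by [e]. *)
have iXe : independent N (X :\ e).
  apply/independentP => Z ZN; apply/negP => sZ.
  have ZX := mcircuit_incl ZN XN (subset_trans sZ (subsetDl _ _)).
  by have := subsetP sZ e; rewrite ZX !inE eX eqxx => /(_ isT).
have sXe : X :\ e \subset S.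
  by apply/subsetP => h; rewrite !inE => /andP[he /(subsetP sX)];
    rewrite !inE (negPf he).
have [I [sXI sI iI cI]] := rank_witness_extend iXe sXe.
have [J [sJ iJ cJ]] := rank_witness (e |: S).
case: (independent_augment iI iJ); first by rewrite cI cJ.
move=> g; rewrite inE => /andP[gI gJ] igI.
have := subsetP sJ g gJ; rewrite !inE => /predU1P[ge|gS].
  move/independentP: igI => /(_ X XN) /negP[]; rewrite ge.
  by rewrite -(setD1K eX) setUS.
have : #|g |: I| <= mrank N S.
  by apply: card_indep_leq_rank => //; rewrite subUset sub1set gS.
by rewrite cardsU1 gI cI ltnn.
Qed.

Lemma spans_sub S T e : S \subset T -> spans S e -> spans T e.
Proof.
move=> sST /spansP[X [XN eX sX]]; apply/spansP; exists X; split=> //.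
exact: subset_trans sX (setUS _ sST).
Qed.

Lemma rank_spans S T : S \subset T ->
  (forall e, e \in T -> e \notin S -> spans S e) -> mrank N T = mrank N S.
Proof.
move=> sST spT.
suff H (U : {set E}) : S \subset U -> U \subset T -> mrank N U = mrank N S.
  by apply: H.
have [n] := ubnP #|U|; elim: n U => // n IH U /ltnSE leU sSU sUT.
have [->|] := eqVneq U S; first by [].
rewrite eq_sym => nUS.
have /properP[_ [e eU eS]] : S \proper U by rewrite properEneq nUS.
have sSUe : S \subset U :\ e by rewrite subsetD1 sSU.
rewrite -(setD1K eU) rankU1 ?setD11 //.
rewrite (spans_sub sSUe) ?addn0; last by apply: spT => //; apply: (subsetP sUT).
apply: IH => //.
  by rewrite (cardsD1 e U) eU in leU.
exact: subset_trans (subsetDl _ _) sUT.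
Qed.

(** Without [e] and [g] the union of the circuits spans [g], by [Z], and with [g]
    it spans [e], by [X]. So adding both raises the rank by nothing, hence adding
    [e] alone does not raise it either. *)
Lemma strong_circuit_elim X Z e g :
  X \in mcircuits N -> Z \in mcircuits N -> g \in X -> g \in Z ->
  e \in X -> e \notin Z ->
  exists W, [/\ W \in mcircuits N, e \in W & W \subset (X :|: Z) :\ g].
Proof.
move=> XN ZN gX gZ eX eZ; pose S := (X :|: Z) :\ g :\ e.
have eg : e != g by apply: contraNneq eZ => ->.
have gS : g \notin S by rewrite !inE eqxx andbF.
have eS : e \notin S by rewrite !inE eqxx.
have spg : spans S g.
  apply/spansP; exists Z; split=> //; apply/subsetP => h hZ.
  rewrite !inE hZ orbT andbT; case: eqVneq => //= hg; rewrite ?andbT.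
  by apply: contraNneq eZ => <-.
have spge : spans (g |: S) e.
  apply/spansP; exists X; split=> //; apply/subsetP => h hX; rewrite !inE hX.
  by case: eqVneq => //= _; case: eqVneq.
have /spansP[W [WN eW sW]] : spans S e.
  apply: contraT => nsp.
  have := rank_mono (setUS [set e] (subsetUr [set g] S)).
  rewrite !rankU1 ?spge ?spg ?(negPf nsp) ?addn0 ?addn1 ?ltnn //.
  by rewrite !inE (negPf eg) eqxx.
exists W; split=> //; apply: subset_trans sW _.
by rewrite subUset sub1set !inE eX eg subsetDl.
Qed.

(** ** Cocircuits *)

Lemma basis_rank B : mbasis N B = independent N B && (#|B| == mrank N [set: E]).
Proof.
apply/maxsetP/andP => [[iB maxB]|[iB /eqP cB]]; split=> //.
  have [J [sBJ _ iJ cJ]] := rank_witness_extend iB (subsetT B).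
  by rewrite -cJ (maxB J).
move=> J iJ sBJ; apply/esym/eqP; rewrite eqEcard sBJ cB.
by rewrite card_indep_leq_rank ?subsetT.
Qed.

Lemma meets_bases_rank D :
  [forall B, mbasis N B ==> (D :&: B != set0)] =
  (mrank N (~: D) < mrank N [set: E]).
Proof.
apply/forall_inP/idP => [meet|lt B].
  have [I [sI iI cI]] := rank_witness (~: D).
  rewrite ltn_neqAle rank_mono ?subsetT // andbT -cI; apply/negP => IE.
  have := meet I; rewrite basis_rank iI IE => /(_ isT) /negP[].
  by rewrite setI_eq0 disjoint_sym disjoints_subset.
rewrite basis_rank => /andP[iB /eqP cB]; apply: contraTneq lt => DB.
rewrite -leqNgt -cB card_indep_leq_rank //.
by rewrite -disjoints_subset disjoint_sym -setI_eq0 DB.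
Qed.

(** Cocircuits are the complements of hyperplanes. *)
Lemma mcocircuitP D : reflect
  (mrank N (~: D) < mrank N [set: E] /\
   forall e, e \in D -> mrank N (e |: ~: D) = mrank N [set: E])
  (mcocircuit N D).
Proof.
apply: (iffP minsetP); rewrite meets_bases_rank => -[ltD minD]; split=> //.
  move=> e eD; apply/eqP; rewrite eqn_leq rank_mono ?subsetT //= leqNgt.
  apply/negP => lt; have /minD : D :\ e \subset D by apply: subsetDl.
  rewrite meets_bases_rank setCD setUC lt => /(_ isT) De.
  by have := eD; rewrite -De setD11.
move=> D'; rewrite meets_bases_rank => ltD' sD'.
apply/eqP; rewrite eqEsubset sD' /=; apply/subsetP => e eD.
apply: contraLR ltD' => eD'; rewrite -leqNgt -(minD e eD) rank_mono //.
by rewrite subUset sub1set inE eD' setCS.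
Qed.

(** The circuit would put [e] into the span of the hyperplane [~: D]. *)
Lemma circuit_cocircuit_neq1 X D e :
  X \in mcircuits N -> mcocircuit N D -> X :&: D <> [set e].
Proof.
move=> XN /mcocircuitP[ltD minD] XD.
have /setIP[eX eD] : e \in X :&: D by rewrite XD set11.
move: ltD; rewrite -(minD e eD) rankU1 ?inE ?eD // addnC.
suff -> : spans (~: D) e by rewrite ltnn.
apply/spansP; exists X; split=> //; apply/subsetP => h hX; rewrite !inE.
have [hD|] := boolP (h \in D); last by rewrite orbT.
by have : h \in X :&: D; [rewrite inE hX hD | rewrite XD inE => ->].
Qed.

(** The hyperplane [~: D] together with [e] spans [f]. *)
Lemma cocircuit_pair_circuit D e f : mcocircuit N D -> e \in D -> f \in D ->
  e != f -> exists2 X, X \in mcircuits N & X :&: D = [set e; f].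
Proof.
move=> DN eD fD ef; have [_ minD] := mcocircuitP _ DN.
have fS : f \notin e |: ~: D by rewrite !inE fD eq_sym (negPf ef).
have /spansP[X [XN fX sX]] : spans (e |: ~: D) f.
  apply: contraT => nsp; have := rank_mono (subsetT (f |: (e |: ~: D))).
  by rewrite rankU1 // nsp (minD e eD) addn1 ltnn.
have sXD : X :&: D \subset [set e; f].
  apply/subsetP => h /setIP[hX hD]; have := subsetP sX h hX.
  by rewrite !inE hD orbF orbC.
exists X => //; apply/eqP; rewrite eqEsubset sXD subUset !sub1set !inE fX fD eD.
rewrite !andbT; apply: contraT => eX; exfalso.
apply: (@circuit_cocircuit_neq1 X D f XN DN).
apply/eqP; rewrite eqEsubset sub1set inE fX fD !andbT.
apply/subsetP => h hXD; have := subsetP sXD h hXD; rewrite !inE.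
case/orP=> // /eqP he; move: hXD eX; rewrite inE he => /andP[-> //].
Qed.

(** The complement of a maximal set containing [S] and not spanning [e]. *)
Lemma cocircuit_avoiding S e : e \notin S -> ~~ spans S e ->
  exists D, [/\ mcocircuit N D, e \in D & [disjoint D & S]].
Proof.
move=> eS nsp; pose P (F : {set E}) := [&& S \subset F, e \notin F & ~~ spans F e].
have PS : P S by rewrite /P subxx eS.
case: (@arg_maxnP _ S P (fun F : {set E} => #|F|) PS) => F /and3P[sSF eF nspF] maxF.
have spU f : f \notin F -> f != e -> spans (f |: F) e.
  move=> fF fe; apply: contraT => nspf; have : P (f |: F).
    by rewrite /P nspf !inE eq_sym (negPf fe) eF (subset_trans sSF) ?subsetUr.
  by move/maxF; rewrite /= cardsU1 fF ltnn.
have rUe : mrank N (e |: F) = mrank N [set: E].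
  apply/esym/rank_spans; first exact: subsetT.
  move=> f _; rewrite in_setU1 negb_or => /andP[fe fF]; apply: contraT => nspf.
  have := rankU1 (S := f |: F) (e := e); rewrite spU // setUCA.
  rewrite !rankU1 // ?inE ?(negPf fe) ?(negPf fF) 1?eq_sym ?(negPf fe) //.
  rewrite nspf nspF (negPf eF) => /(_ isT); rewrite !addn1 addn0 => h.
  have : mrank N F + ~~ spans F f <= (mrank N F).+1.
    by case: (spans F f); rewrite ?addn0 ?addn1.
  by rewrite -h ltnn.
exists (~: F); split; last 2 first.
- by rewrite inE.
- by rewrite disjoint_sym disjoints_subset setCK.
apply/mcocircuitP; rewrite setCK; split.
  by rewrite -rUe rankU1 // nspF addn1.
move=> f; rewrite inE => fF; have [->//|fe] := eqVneq f e.
apply/eqP; rewrite eqn_leq rank_mono ?subsetT //= -rUe.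
have := rankU1 (S := f |: F) (e := e); rewrite spU // addn0 => <-.
  by rewrite rank_mono // setUS ?subsetUr.
by rewrite !inE eq_sym (negPf fe).
Qed.

End MatroidRank.

(** * Every cocircuit of the underlying matroid carries an orthogonal signature *)

Section Signature.
Local Open Scope nat_scope.
Variables (E : finType) (M : oriented_matroid E).
Implicit Types (C W : {set E}) (X Y Z : signed_set E) (e f g h : E).
Local Notation N := (underlying M).

Lemma supp_circuit X : X \in circuits M -> supp X \in mcircuits N.
Proof. exact: imset_f. Qed.

Lemma circuit_sign X h : X \in circuits M -> h \in supp X ->
  (h \in X.2) = (h \notin X.1).
Proof.
move=> XM; rewrite inE; move/circuit_disjoint: XM; rewrite disjoints_subset.
by move/subsetP/(_ h); rewrite inE; case: (h \in X.1) => [/(_ isT)/negPf->|].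
Qed.

Lemma circuit_lift C e b : C \in mcircuits N -> e \in C ->
  exists X, [/\ X \in circuits M, supp X = C & (e \in X.1) = b].
Proof.
case/imsetP=> X XM -> eX; have [eb|eb] := eqVneq (e \in X.1) b.
  by exists X.
exists (sopp X); rewrite supp_sopp circuit_opp //; split=> //.
by rewrite /sopp /= circuit_sign //; case: (e \in X.1) b eb => -[].
Qed.

(** Signed elimination between [X] and the opposite of [Y], with the sign of [g]
    left open. *)
Lemma circuit_elim_same X Y g : X \in circuits M -> Y \in circuits M ->
  supp X != supp Y -> g \in supp X -> g \in supp Y ->
  (g \in X.1) = (g \in Y.1) ->
  exists Z, [/\ Z \in circuits M, g \notin supp Z,
    Z.1 \subset X.1 :|: Y.2 & Z.2 \subset X.2 :|: Y.1].
Proof.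
move=> XM YM nXY gX gY sg; have [gX1|gX1] := boolP (g \in X.1).
  have [|| Z ZM /andP[s1 s2]] := circuit_elim (e := g) XM (circuit_opp YM).
  - by rewrite soppK => XY; rewrite XY eqxx in nXY.
  - by rewrite inE gX1 -sg.
  move: s1 s2; rewrite !subsetD1 => /andP[s1 g1] /andP[s2 g2].
  by exists Z; rewrite inE negb_or g1 g2.
have [|| Z ZM /andP[s1 s2]] := circuit_elim (e := g) (circuit_opp YM) XM.
- by move=> YX; case/eqP: nXY; rewrite -(supp_sopp X) -YX supp_sopp.
- by rewrite inE /= !circuit_sign // -sg gX1.
move: s1 s2; rewrite !subsetD1 => /andP[s1 g1] /andP[s2 g2].
by exists Z; rewrite inE negb_or g1 g2; split=> //; rewrite setUC.
Qed.

Variable D : {set E}.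
Hypothesis DN : mcocircuit N D.

Lemma pair_circuit W e f : W \in mcircuits N -> W :&: D \subset [set e; f] ->
  W :&: D != set0 -> W :&: D = [set e; f].
Proof.
move=> WN sW W0; have n1 := circuit_cocircuit_neq1 WN DN.
apply/eqP; rewrite eqEsubset sW; apply: contraT => /subsetPn[h hef hW].
have [k kW] := set0Pn _ W0; case: (n1 k).
apply/eqP; rewrite eqEsubset sub1set kW andbT; apply/subsetP => l lW.
have := subsetP sW l lW; have := subsetP sW k kW; move: hef; rewrite !inE.
by move=> /pred2P[] hE /pred2P[] kE /pred2P[] lE; subst=> //; rewrite ?lW ?kW in hW.
Qed.

(** Both circuits are positive at [e], so that the relative sign of [e] and [f] is
    read off at [f]. *)
Definition disagree e f X X' :=
  [/\ (X \in circuits M) && (X' \in circuits M),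
      supp X :&: D = [set e; f], supp X' :&: D = [set e; f],
      (e \in X.1) && (e \in X'.1) & (f \in X.1) != (f \in X'.1)].

Lemma disagreeC e f X X' : disagree e f X X' -> disagree e f X' X.
Proof.
by case=> XM XD XD' eX fX; split=> //; rewrite 1?andbC 1?eq_sym.
Qed.

(** A circuit [V] through [e] obtained from [X'] and [W], without an element of [W]
    outside [X], makes with [X] a pair with smaller union; so it agrees with [X] and
    disagrees with [X']. The union of this second pair lies in [supp X' :|: W] and
    cannot be smaller either, which forces [W] to contain what [X'] lacks. *)
Lemma minimal_disagree_cover e f X X' W : e != f -> disagree e f X X' ->
  (forall Y Y', disagree e f Y Y' ->
     #|supp X :|: supp X'| <= #|supp Y :|: supp Y'|) ->
  W \in mcircuits N -> W \subset supp X :|: supp X' -> W :&: D = set0 ->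
  supp X :\: supp X' \subset W.
Proof.
move=> ef dXX' min WN sW W0; have [/andP[XM X'M] XD X'D /andP[eX eX'] fX] := dXX'.
have nD h : h \in W -> h \in D -> False.
  by move=> hW hD; have := in_set0 h; rewrite -W0 inE hW hD.
have eD : e \in supp X :&: D by rewrite XD !inE eqxx.
have {}eD : e \in D by case/setIP: eD.
have eW : e \notin W by apply/negP => /nD/(_ eD).
have [g gW gX] : exists2 g, g \in W & g \notin supp X.
  apply/subsetPn/negP => sWX; move: W0.
  rewrite (mcircuit_incl WN (supp_circuit XM) sWX).
  by rewrite XD => /setP/(_ e); rewrite !inE eqxx.
have gX' : g \in supp X'.
  by have := subsetP sW g gW; rewrite !inE in gX *; rewrite (negPf gX).
have eX's : e \in supp X' by rewrite inE eX'.
have [V [VN eV sV]] := strong_circuit_elim (supp_circuit X'M) WN gX' gW eX's eW.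
have VD : V :&: D = [set e; f].
  apply: pair_circuit => //; last by apply/set0Pn; exists e; rewrite inE eV.
  rewrite -X'D; apply/subsetP => h /setIP[hV hD]; rewrite inE hD andbT.
  have := subsetP sV h hV; rewrite 2!inE => /andP[_]; rewrite inE => /orP[//|hW].
  by case: (nD h hW hD).
have [Y [YM Ys eY]] := circuit_lift true VN eV.
have gV : g \notin V by apply/negP => /(subsetP sV); rewrite !inE eqxx.
have fXY : (f \in X.1) = (f \in Y.1).
  apply/eqP; apply: contraT => nXY.
  have /min : disagree e f X Y by split; rewrite ?XM ?YM ?Ys ?eX.
  rewrite leqNgt => /negP[]; apply: proper_card; apply/properP; split.
    rewrite subUset subsetUl Ys; apply: subset_trans sV _.
    by apply: subset_trans (subsetDl _ _) _; rewrite subUset subsetUr.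
  by exists g; rewrite in_setU ?gX' ?orbT // Ys (negPf gX) (negPf gV).
have /min le : disagree e f X' Y.
  by split; rewrite ?X'M ?YM ?Ys ?eX' // -fXY eq_sym.
apply/subsetP => h; rewrite inE => /andP[hX' hX]; apply: contraLR le => hW.
rewrite -ltnNge; apply: proper_card; apply/properP; split.
  rewrite subUset subsetUr Ys; apply: subset_trans sV _.
  by apply: subset_trans (subsetDl _ _) _; rewrite subUset subsetUr.
exists h; first by rewrite in_setU hX.
rewrite in_setU (negPf hX') Ys; apply: contra hW => /(subsetP sV).
by rewrite 2!inE in_setU (negPf hX') => /andP[].
Qed.

(** In a disagreeing pair with smallest union, eliminate [e] to get [Z], which
    avoids [D]; then eliminate between [X'] and [Z] an element [g] outside [X].
    The result either avoids [D], against the covering property, or has the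
    relative signs of [X'] and gives a smaller pair with [X]. *)
Lemma circuit_signs_agree e f X X' :
  X \in circuits M -> X' \in circuits M -> e != f ->
  supp X :&: D = [set e; f] -> supp X' :&: D = [set e; f] ->
  e \in X.1 -> e \in X'.1 -> (f \in X.1) = (f \in X'.1).
Proof.
move=> XM X'M ef XD X'D eX eX'; apply/eqP; apply: contraT => fXX'.
have {X'M XM XD X'D eX eX' fXX'} : disagree e f X X' by split; rewrite ?XM ?eX.
have [n] := ubnP #|supp X :|: supp X'|; elim: n X X' => // n IH X X' /ltnSE le dXX'.
have min Y Y' : disagree e f Y Y' ->
    #|supp X :|: supp X'| <= #|supp Y :|: supp Y'|.
  move=> dY; rewrite leqNgt; apply: contraT => /negPn lt.
  exact: IH (leq_trans lt le) dY.
have min' Y Y' : disagree e f Y Y' ->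
    #|supp X' :|: supp X| <= #|supp Y :|: supp Y'|.
  by rewrite setUC; apply: min.
have cov W := minimal_disagree_cover (W := W) ef (disagreeC dXX') min'.
have [/andP[XM X'M] XD X'D /andP[eX eX'] fX] := dXX'.
have eXs : e \in supp X by rewrite inE eX.
have eX's : e \in supp X' by rewrite inE eX'.
have eD : e \in D by have : e \in supp X :&: D; [rewrite XD !inE eqxx | case/setIP].
have fs : (f \in supp X) && (f \in supp X').
  have : f \in supp X :&: D by rewrite XD !inE eqxx orbT.
  have : f \in supp X' :&: D by rewrite X'D !inE eqxx orbT.
  by rewrite !in_setI => /andP[-> _] /andP[->].
have [fXs fX's] := andP fs.
have nXX' : supp X != supp X'.
  apply: contraNneq fX => sE.
  case: (circuit_incl XM X'M); first by rewrite sE.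
    by move->.
  by move=> Xo; move: eX; rewrite Xo /= circuit_sign // eX'.
have [Z [ZM eZ sZ1 sZ2]] :=
  circuit_elim_same XM X'M nXX' eXs eX's (etrans eX (esym eX')).
have sZ : supp Z \subset supp X :|: supp X'.
  rewrite subUset (subset_trans sZ1) ?(subset_trans sZ2) //;
    by apply/subsetP => h; rewrite !inE => /orP[] ->; rewrite ?orbT.
have Z0 : supp Z :&: D = set0.
  apply: contraNeq eZ => nZ.
  have /setP/(_ e) : supp Z :&: D = [set e; f].
    apply: pair_circuit => //; first exact: supp_circuit.
    have -> : [set e; f] = (supp X :|: supp X') :&: D.
      by rewrite setIUl XD X'D setUid.
    exact: setSI.
  by rewrite !inE eqxx => /andP[].
have nZD h : h \in D -> h \notin supp Z.
  by move=> hD; apply/negP => hZ; have := in_set0 h; rewrite -Z0 inE hZ hD.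
have fD : f \in D.
  by have : f \in supp X :&: D; [rewrite XD !inE eqxx orbT | case/setIP].
have [g gZ gX] : exists2 g, g \in supp Z & g \notin supp X.
  apply/subsetPn/negP => sZX.
  have := mcircuit_incl (supp_circuit ZM) (supp_circuit XM) sZX => ZX.
  by move: eZ; rewrite ZX eXs.
have gX' : g \in supp X'.
  by have := subsetP sZ g gZ; rewrite in_setU (negPf gX).
have nX'Z : supp X' != supp Z by apply: contraNneq eZ => <-.
have [Z' [Z'M Z's Z'g]] := circuit_lift (g \in X'.1) (supp_circuit ZM) gZ.
have gZ' : g \in supp Z' by rewrite Z's.
have nX'Z' : supp X' != supp Z' by rewrite Z's.
have [V [VM gV sV1 sV2]] := circuit_elim_same X'M Z'M nX'Z' gX' gZ' (esym Z'g).
have sV : supp V \subset supp X' :|: supp Z.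
  rewrite -Z's subUset (subset_trans sV1) ?(subset_trans sV2) //;
    by apply/subsetP => h; rewrite !inE => /orP[] ->; rewrite ?orbT.
have sVS : supp V \subset supp X' :|: supp X.
  by apply: subset_trans sV _; rewrite subUset subsetUl setUC.
have [VD|VD] := eqVneq (supp V :&: D) set0.
  have /subsetP/(_ g) := cov _ (supp_circuit VM) sVS VD.
  by rewrite inE gX gX' (negPf gV) => /(_ isT).
have {}VD : supp V :&: D = [set e; f].
  apply: pair_circuit => //; first exact: supp_circuit.
  rewrite -X'D; apply/subsetP => h /setIP[hV hD]; rewrite inE hD andbT.
  by have := subsetP sV h hV; rewrite in_setU (negPf (nZD h hD)) orbF.
have sgn h : h \in [set e; f] -> h \in supp X' -> (h \in V.1) = (h \in X'.1).
  rewrite -VD => /setIP[hV hD] hX'.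
  have := nZD h hD; rewrite -Z's in_setU negb_or => /andP[hZ1 hZ2].
  apply/idP/idP => [/(subsetP sV1)|hX1]; first by rewrite in_setU (negPf hZ2) orbF.
  have := circuit_sign X'M hX'; rewrite hX1 => hX2.
  move: hV; rewrite in_setU => /orP[//|/(subsetP sV2)].
  by rewrite in_setU hX2 (negPf hZ1).
have /min : disagree e f X V.
  by split; rewrite ?XM ?VM ?eX ?sgn // !inE eqxx ?orbT.
rewrite leqNgt => /negP[]; apply: proper_card; apply/properP; split.
  by rewrite subUset subsetUl (subset_trans sVS) ?(setUC (supp X')).
by exists g; rewrite in_setU ?gX' ?orbT // (negPf gX) (negPf gV).
Qed.

(** Take [X'] with [supp X :|: supp X'] smallest. If a circuit [Z] of the union
    avoided [D], eliminating from [X'] and [Z], while keeping [e], an element of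
    [Z] outside [X] would make the union smaller. *)
Lemma linking_circuit X e f : X \in circuits M -> f \in supp X :&: D ->
  e \in D -> e != f ->
  exists W, [/\ W \in mcircuits N, W :&: D = [set e; f] &
    forall Z : {set E}, Z \in mcircuits N -> Z \subset supp X :|: W ->
      Z :&: D != set0].
Proof.
move=> XM /setIP[fX fD] eD ef.
have [W0 W0N W0D] := cocircuit_pair_circuit DN eD fD ef.
pose P W := (W \in mcircuits N) && (W :&: D == [set e; f]).
have PW0 : P W0 by rewrite /P W0N W0D eqxx.
case: (@arg_minnP _ W0 P (fun W => #|supp X :|: W|) PW0) => W /andP[WN /eqP WD] min.
exists W; split=> // Z ZN sZ; apply/negP => /eqP Z0.
have nZD h : h \in D -> h \notin Z.
  by move=> hD; apply/negP => hZ; have := in_set0 h; rewrite -Z0 inE hZ hD.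
have [g gZ gX] : exists2 g, g \in Z & g \notin supp X.
  apply/subsetPn/negP => sZX; have ZX := mcircuit_incl ZN (supp_circuit XM) sZX.
  by move: (nZD f fD); rewrite ZX fX.
have gW : g \in W by have := subsetP sZ g gZ; rewrite in_setU (negPf gX).
have eW : e \in W by have : e \in W :&: D; [rewrite WD !inE eqxx | case/setIP].
have [V [VN eV sV]] := strong_circuit_elim WN ZN gW gZ eW (nZD e eD).
have /min : P V.
  rewrite /P VN; apply/eqP; apply: pair_circuit => //.
    rewrite -WD; apply/subsetP => h /setIP[hV hD]; rewrite inE hD andbT.
    have := subsetP sV h hV; rewrite 2!inE in_setU (negPf (nZD h hD)) orbF.
    by case/andP.
  by apply/set0Pn; exists e; rewrite inE eV.
rewrite leqNgt => /negP[]; apply: proper_card; apply/properP; split.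
  rewrite subUset subsetUl; apply: subset_trans sV _.
  by apply: subset_trans (subsetDl _ _) _; rewrite subUset subsetUr.
exists g; first by rewrite in_setU gW orbT.
rewrite in_setU (negPf gX); apply/negP => /(subsetP sV).
by rewrite !inE eqxx.
Qed.

(** With [e] positive the other signs are forced: orthogonality to a circuit that
    meets [D] only in [e] and [f] determines the sign of [f]. *)
Definition signature e : signed_set E :=
  let D2 := [set f in D | (e != f) && [exists X in circuits M,
     [&& supp X :&: D == [set e; f], e \in X.1 & f \in X.1]]] in
  (D :\: D2, D2).

Lemma supp_signature e : supp (signature e) = D.
Proof.
rewrite /supp /signature /=; apply/setP => h; rewrite !inE.
by case: (h \in D) => //=; rewrite andbT orNb.
Qed.

Lemma signature1 e h :
  (h \in (signature e).1) = (h \notin (signature e).2) && (h \in D).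
Proof. exact: in_setD. Qed.

Lemma signatureN e f X : X \in circuits M -> e != f ->
  supp X :&: D = [set e; f] -> e \in X.1 ->
  (f \in (signature e).2) = (f \in X.1).
Proof.
move=> XM ef XD eX; have fD : f \in D.
  by have : f \in supp X :&: D; [rewrite XD !inE eqxx orbT | case/setIP].
rewrite !inE fD ef /=; apply/exists_inP/idP => [[Y YM]|fX]; last first.
  by exists X; rewrite ?XD ?eqxx ?eX.
case/and3P=> /eqP YD eY fY.
by rewrite (circuit_signs_agree XM YM ef XD YD eX eY).
Qed.

(** Assume that [X] has everywhere on [D] the signs of the signature, and choose
    [f] in [X] and [D], other than [e]. Link [f] to [e] by a circuit whose sign
    at [f] is opposite to that of [X]; then its sign at [e] is that of the
    signature. Eliminating [f] gives a circuit with the same property that meets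
    [D] in fewer elements other than [e]. *)
Lemma signature_not_conformal e X : e \in D -> X \in circuits M ->
  supp X :&: D != set0 ->
  ~~ ([disjoint X.1 & (signature e).2] && [disjoint X.2 & (signature e).1]).
Proof.
move=> eD; have [n] := ubnP #|(supp X :&: D) :\ e|.
elim: n X => // n IH X /ltnSE le XM XD0; apply/negP => /andP[d1 d2].
have [f fXD fe] : exists2 f, f \in supp X :&: D & f != e.
  apply/exists_inP; apply: contraT; rewrite negb_exists_in => /forall_inP nf.
  case: (@circuit_cocircuit_neq1 _ N _ D e (supp_circuit XM) DN).
  have [k kXD] := set0Pn _ XD0; have /eqP ke : k == e by rewrite -[_ == _]negbK nf.
  apply/eqP; rewrite eqEsubset sub1set -{2}ke kXD andbT.
  by apply/subsetP => h /nf; rewrite negbK inE.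
have ef : e != f by rewrite eq_sym.
have [W [WN WD linkW]] := linking_circuit XM fXD eD ef.
have [fX fD] := setIP fXD.
have [eW fW] : e \in W /\ f \in W.
  have : e \in W :&: D by rewrite WD !inE eqxx.
  have : f \in W :&: D by rewrite WD !inE eqxx orbT.
  by rewrite !in_setI => /andP[-> _] /andP[->].
have [X' [X'M X's X'f]] := circuit_lift (f \in X.1) WN fW.
have X'D : supp X' :&: D = [set e; f] by rewrite X's.
have fX' : f \in supp X' by rewrite X's.
have eX' : e \in supp X' by rewrite X's.
have nX1 h : h \in X.1 -> h \notin (signature e).2.
  by move=> hX; rewrite (disjointFr d1).
have nX2 h : h \in X.2 -> h \notin (signature e).1.
  by move=> hX; rewrite (disjointFr d2).
have eS2 : e \notin (signature e).2 by rewrite !inE eqxx andbF.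
have eS1 : e \in (signature e).1 by rewrite signature1 eS2.
have eX'1 : e \notin X'.1.
  apply/negP => eX'1; have := signatureN X'M ef X'D eX'1; rewrite X'f.
  have [fX1|fX1] := boolP (f \in X.1); first by rewrite (negPf (nX1 f fX1)).
  have fX2 : f \in X.2 by rewrite circuit_sign.
  by have := nX2 f fX2; rewrite signature1 fD andbT negbK => ->.
have nXX' : supp X != supp X'.
  apply/eqP => sXX'; have eX : e \in supp X by rewrite sXX'.
  have eX1 : e \in X.1.
    by apply: contraT; rewrite -circuit_sign // => /nX2; rewrite eS1.
  case: (circuit_incl XM X'M); first by rewrite sXX'.
    by move=> XX'; rewrite -XX' eX1 in eX'1.
  by move=> XX'; move: X'f; rewrite XX' /= circuit_sign //; case: (f \in X'.1).
have [Z [ZM fZ sZ1 sZ2]] := circuit_elim_same XM X'M nXX' fX fX' (esym X'f).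
have sZ : supp Z \subset supp X :|: supp X'.
  rewrite subUset (subset_trans sZ1) ?(subset_trans sZ2) //;
    by apply/subsetP => h; rewrite !inE => /orP[] ->; rewrite ?orbT.
have ZD0 : supp Z :&: D != set0.
  by apply: linkW; rewrite -?X's //; apply: supp_circuit.
have onlye h : h \in supp Z -> h \in D -> h \in supp X' -> h = e.
  move=> hZ hD hX'; have : h \in supp X' :&: D by rewrite inE hX'.
  by rewrite X'D !inE => /pred2P[//|hf]; rewrite -hf hZ in fZ.
have ltZ : #|(supp Z :&: D) :\ e| < n.
  apply: leq_trans le; apply: proper_card; apply/properP; split.
    apply/subsetP => h; rewrite !in_setD1 !in_setI => /and3P[he hZ hD].
    rewrite he hD andbT; have := subsetP sZ h hZ; rewrite in_setU.
    by case/orP=> // /(onlye h hZ hD) /eqP; rewrite (negPf he).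
  by exists f; rewrite in_setD1 in_setI ?fe ?fX // (negPf fZ) andbF.
have /negP[] := IH Z ltZ ZM ZD0; apply/andP; split.
  apply/pred0P => h /=; apply/negP => /andP[hZ hS].
  have hD : h \in D by rewrite -(supp_signature e) inE hS orbT.
  have := subsetP sZ1 h hZ; rewrite inE => /orP[/nX1|hX'2]; first by rewrite hS.
  have he := onlye h; rewrite !(inE, hZ, hX'2, orbT) in he.
  by move: hS; rewrite he // (negPf eS2).
apply/pred0P => h /=; apply/negP => /andP[hZ hS].
have hD : h \in D by rewrite -(supp_signature e) inE hS.
have := subsetP sZ2 h hZ; rewrite inE => /orP[/nX2|hX'1]; first by rewrite hS.
have he := onlye h; rewrite !(inE, hZ, hX'1, orbT) in he.
by move: hX'1; rewrite he // (negPf eX'1).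
Qed.

Lemma cocircuit_signature e : e \in D ->
  exists Y, [/\ Y \in cocircuits M, supp Y = D & e \in Y.1].
Proof.
move=> eD; exists (signature e); rewrite supp_signature; split=> //; last first.
  by rewrite !inE eD eqxx !andbF.
rewrite inE supp_signature DN andbC /=; apply/andP; split; last first.
  by rewrite disjoint_sym disjoints_subset; apply/subsetP => h; rewrite !inE => ->.
apply/forall_inP => X XM; rewrite /sorthogonal supp_signature -setI_eq0.
have [//|XD /=] := eqVneq; apply/andP; split; last first.
  have := signature_not_conformal eD XM XD.
  by rewrite -setI_eq0 -setI_eq0 -setU_eq0.
have := signature_not_conformal eD (circuit_opp XM).
by rewrite supp_sopp -!setI_eq0 -setU_eq0 /= setUC; apply.
Qed.

End Signature.

(** * Painting *)

Section Painting.
Variable E : finType.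
Implicit Types (A C D : {set E}) (X Y Z : signed_set E) (e f g h w : E).
Implicit Types F : {set signed_set E}.

Lemma disjoint_setU1 e C D :
  [disjoint e |: C & D] = (e \notin D) && [disjoint C & D].
Proof. by rewrite !disjoints_subset subUset sub1set inE. Qed.

(** Positivity after reorientation on [A]; negativity is [pos (~: A)]. *)
Definition pos A X e : bool := if e \in A then e \in X.2 else e \in X.1.

Lemma posE A X e : pos A X e = (e \in (reorient_set A X).1).
Proof. by rewrite /pos !inE; case: (e \in A); rewrite ?andbF ?andbT ?orbF. Qed.

Lemma negE A X e : pos (~: A) X e = (e \in (reorient_set A X).2).
Proof. by rewrite /pos !inE; case: (e \in A); rewrite ?andbF ?andbT ?orbF. Qed.

Lemma mem_supp_pos A X e : (e \in supp X) = pos A X e || pos (~: A) X e.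
Proof. by rewrite posE negE -in_setU -[_ :|: _]/(supp _) supp_reorient. Qed.

Lemma pos_supp A X e : pos A X e -> e \in supp X.
Proof. by rewrite (mem_supp_pos A) => ->. Qed.

Lemma pos_neg A X e : [disjoint X.1 & X.2] -> pos A X e -> ~~ pos (~: A) X e.
Proof.
move=> dX; rewrite /pos inE; case: (e \in A) => /= eX.
  by rewrite (disjointFl dX).
by rewrite (disjointFr dX).
Qed.

Lemma eq_pos A A' X e : (e \in A) = (e \in A') -> pos A X e = pos A' X e.
Proof. by rewrite /pos => ->. Qed.

(** For [F] the signed circuits: in the reorientation on [A], the minor obtained by
    deleting [D] and contracting [C] has a positive circuit through [e]; the traces
    on the minor of the members of [F] need not be minimal, but they are unions of
    positive circuits. For [F] the signed cocircuits, deletion and contraction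
    exchange their roles. *)
Definition paintable F A D C e : bool :=
  [exists X in F, [&& pos A X e, [disjoint supp X & D] &
                      [forall f, pos (~: A) X f ==> (f \in C)]]].

Lemma paintableP F A D C e : reflect
  (exists X, [/\ X \in F, pos A X e, forall f, f \in supp X -> f \notin D &
                 forall f, pos (~: A) X f -> f \in C])
  (paintable F A D C e).
Proof.
apply: (iffP exists_inP) => [[X XF /and3P[eX dX nX]]|[X [XF eX dX nX]]].
  exists X; split=> // f; first by move=> fX; rewrite (disjointFr dX).
  exact/implyP/(forallP nX).
exists X => //; rewrite eX /=; apply/andP; split.
  by rewrite disjoints_subset; apply/subsetP => f /dX; rewrite inE.
by apply/forallP => f; apply/implyP/nX.
Qed.

Lemma paintable_mono F A D D' C C' e : D' \subset D -> C \subset C' ->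
  paintable F A D C e -> paintable F A D' C' e.
Proof.
move=> sD sC /paintableP[X [XF eX dX nX]]; apply/paintableP; exists X.
split=> // f; last by move/nX; apply: subsetP.
by move/dX; apply: contra; apply: subsetP.
Qed.

Lemma eq_paintable F A A' D C e : e \notin C :|: D ->
  (forall h, h \notin C :|: D -> (h \in A) = (h \in A')) ->
  paintable F A D C e = paintable F A' D C e.
Proof.
have imp (B B' : {set E}) : e \notin C :|: D ->
    (forall h, h \notin C :|: D -> (h \in B) = (h \in B')) ->
    paintable F B D C e -> paintable F B' D C e.
  move=> eCD BB' /paintableP[X [XF eX dX nX]]; apply/paintableP; exists X.
  split=> //; first by rewrite -(eq_pos _ (BB' e eCD)).
  move=> f fX; have [//|fC] := boolP (f \in C).
  have fD : f \notin D by apply: dX; apply: pos_supp fX.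
  case/negP: (fC); apply: nX; rewrite (@eq_pos _ (~: B')) // !in_setC BB' //.
  by rewrite inE negb_or fC.
by move=> eCD AA'; apply/idP/idP; apply: imp => // h /AA' ->.
Qed.

Section Flip.
Variables (A A' : {set E}) (w : E).
Hypothesis flip : forall h, (h \in A') = (h \in A) (+) (h == w).

Lemma flip_pos_other X h : h != w -> pos A' X h = pos A X h.
Proof. by move=> hw; apply: eq_pos; rewrite flip (negPf hw) addbF. Qed.

Lemma flip_neg_other X h : h != w -> pos (~: A') X h = pos (~: A) X h.
Proof. by move=> hw; apply: eq_pos; rewrite !inE flip (negPf hw) addbF. Qed.

Lemma flip_neg X : pos (~: A') X w = pos A X w.
Proof. by apply: eq_pos; rewrite inE flip eqxx addbT negbK. Qed.

(** In the contraction of [w] the sign of [w] is free. *)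
Lemma paintable_contract F D C e :
  (forall X, X \in F -> [disjoint X.1 & X.2]) ->
  w \notin C :|: D -> e \notin w |: (C :|: D) ->
  paintable F A D (w |: C) e = paintable F A D C e || paintable F A' D C e.
Proof.
move=> dF; rewrite !inE !negb_or => /andP[wC wD] /and3P[ew eC eD]; apply/idP/idP.
  case/paintableP=> X [XF eX dX nX]; have [wX|wX] := boolP (pos (~: A) X w).
    apply/orP; right; apply/paintableP; exists X; split=> //.
      by rewrite flip_pos_other.
    move=> f; have [->|fw] := eqVneq f w.
      by rewrite flip_neg => /(pos_neg (dF X XF)); rewrite wX.
    rewrite flip_neg_other // => /nX; rewrite in_setU1.
    by case/predU1P=> // /eqP; rewrite (negPf fw).
  apply/orP; left; apply/paintableP; exists X; split=> // f fX.
  have := nX f fX; rewrite in_setU1 => /predU1P[fw|//].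
  by rewrite -fw fX in wX.
case/orP; last rewrite (@eq_paintable F A A').
- exact/paintable_mono/subsetUr.
- exact/paintable_mono/subsetUr.
- by rewrite !inE !negb_or ew eC.
move=> h; rewrite !inE !negb_or flip => /andP[/andP[/negPf-> _] _].
by rewrite addbF.
Qed.

(** A member of [F] that avoids [w] would be a witness for [A'] as well, and a
    member that is negative at [w] is excluded because [w] is not contracted. *)
Lemma paintable_flip_pos F D C e : w \notin C -> e != w ->
  paintable F A D C e -> ~~ paintable F A' D C e -> paintable F A D C w.
Proof.
move=> wC ew /paintableP[X [XF eX dX nX]] nA'; apply/paintableP; exists X.
split=> //; apply: contraT => wX; case/negP: nA'; apply/paintableP; exists X.
split=> //; first by rewrite flip_pos_other.
move=> f; have [->|fw] := eqVneq f w; first by rewrite flip_neg (negPf wX).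
by rewrite flip_neg_other //; apply: nX.
Qed.

End Flip.

Lemma flipC A A' w : (forall h, (h \in A') = (h \in A) (+) (h == w)) ->
  forall h, (h \in A) = (h \in A') (+) (h == w).
Proof. by move=> flip h; rewrite flip -addbA addbb addbF. Qed.

Variable M : oriented_matroid E.
Local Notation N := (underlying M).

Lemma cocircuit_disjoint Y : Y \in cocircuits M -> [disjoint Y.1 & Y.2].
Proof. by rewrite inE => /and3P[]. Qed.

Lemma cocircuit_opp Y : Y \in cocircuits M -> sopp Y \in cocircuits M.
Proof.
rewrite !inE supp_sopp disjoint_sym => /and3P[-> -> /forall_inP oY] /=.
apply/forall_inP => X /oY; rewrite /sorthogonal supp_sopp => /orP[->//|].
by rewrite andbC => ->; rewrite orbT.
Qed.

Lemma orthogonal_opposite A X Y e :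
  X \in circuits M -> Y \in cocircuits M -> pos A X e -> pos A Y e ->
  exists f, pos A X f && pos (~: A) Y f || pos (~: A) X f && pos A Y f.
Proof.
move=> XM; rewrite inE => /and3P[_ _ /forall_inP/(_ X XM)].
rewrite /sorthogonal => /orP[dXY /pos_supp eX /pos_supp eY|].
  by have := disjointFr dXY eX; rewrite eY.
case/andP=> _ /set0Pn[f fXY] _ _; exists f.
by move: fXY; rewrite /pos !inE; case: (f \in A) => //=; rewrite orbC.
Qed.

(** The case where a single element [e] is left: [e] is a loop of the minor or it
    is not, and then a cocircuit contains [e] and avoids [C]. *)
Lemma paintable_spans A C e : e \notin C ->
  paintable (circuits M) A (~: (e |: C)) C e = spans N C e.
Proof.
move=> eC; apply/paintableP/spansP => [[X [XM eX dX _]]|[W [WN eW sW]]].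
  exists (supp X); split; [exact: supp_circuit | exact: pos_supp eX|].
  by apply/subsetP => h /dX; rewrite inE negbK.
have [X [XM Xs Xe]] := circuit_lift (e \notin A) WN eW.
have eX : pos A X e.
  by rewrite /pos (circuit_sign XM) ?Xs // Xe; case: (e \in A).
exists X; split=> // f; first by rewrite Xs inE negbK; apply: subsetP.
move=> fX; have := subsetP sW f; rewrite -Xs (pos_supp fX) in_setU1.
case/(_ isT)/predU1P=> // fe; move: fX; rewrite fe.
by have /negPf-> := pos_neg (circuit_disjoint XM) eX.
Qed.

Lemma paintable_unspanned A C e : e \notin C -> ~~ spans N C e ->
  paintable (cocircuits M) A C (~: (e |: C)) e.
Proof.
move=> eC /(cocircuit_avoiding eC)[D [DN eD dDC]].
have [Y [YM Ys eY]] := cocircuit_signature DN eD.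
have [Z [ZM Zs eZ]] : exists Z, [/\ Z \in cocircuits M, supp Z = D & pos A Z e].
  have [eA|eA] := boolP (e \in A).
    by exists (sopp Y); rewrite cocircuit_opp // supp_sopp /pos eA.
  by exists Y; rewrite /pos (negPf eA).
apply/paintableP; exists Z; split=> // f.
  by rewrite Zs => fD; rewrite (disjointFr dDC).
move=> fZ; rewrite !inE negb_or; apply/andP; split.
  by apply: contraTneq fZ => ->; apply: pos_neg (cocircuit_disjoint ZM) eZ.
have fD : f \in D by rewrite -Zs (pos_supp fZ).
by rewrite (disjointFr dDC).
Qed.

(** The painting theorem. The two sides exclude each other by orthogonality. For
    the other half, pick another element [f], and use the statement with [f] added
    to [D], then with [f] added to [C]: unless this answers the question, it gives
    a cocircuit and a circuit that are both negative at [f], and that nowhere have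
    opposite signs although they meet in [e]. *)
Lemma painting A D C e : [disjoint C & D] -> e \notin C :|: D ->
  paintable (circuits M) A D C e = ~~ paintable (cocircuits M) A C D e.
Proof.
move=> dCD eCD; apply/idP/idP.
  case/paintableP=> X [XM eX dX nX]; apply/paintableP => -[Y [YM eY dY nY]].
  have [f /orP[]/andP[fX fY]] := orthogonal_opposite XM YM eX eY.
    by have := dX f (pos_supp fX); rewrite nY.
  by have := dY f (pos_supp fY); rewrite nX.
apply: contraNT.
have [n] := ubnP #|~: (C :|: D)|; elim: n C D dCD eCD => // n IH C D dCD eCD.
move=> /ltnSE le nX.
have [/subsetP all_e|/subsetPn[f fCD fe]] :=
    boolP (~: (C :|: D) \subset [set e]).
  have eC : e \notin C by apply: contra eCD; rewrite inE => ->.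
  have DE : D = ~: (e |: C).
    apply/setP => h; rewrite !inE negb_or.
    have [->|he] := eqVneq h e.
      by apply/negbTE; apply: contra eCD; rewrite inE orbC => ->.
    have [hC|hC] := boolP (h \in C); first by rewrite (disjointFr dCD).
    by apply: contraNT he => hD; rewrite -in_set1 all_e // !inE negb_or hC.
  by rewrite DE paintable_unspanned // -(paintable_spans A) // -DE.
move: fCD; rewrite !inE negb_or in fe *; case/andP=> fC fD.
have ltf : (#|~: (f |: (C :|: D))| < n)%N.
  apply: leq_trans le; apply: proper_card; apply/properP; split.
    by rewrite setCS subsetUr.
  by exists f; rewrite !inE ?eqxx // negb_or fC.
have nXD : ~~ paintable (circuits M) A (f |: D) C e.
  by apply: contra nX; apply: paintable_mono; rewrite ?subsetUr.
have /paintableP[Y [YM eY dY nY]] : paintable (cocircuits M) A C (f |: D) e.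
  apply: IH nXD; last by rewrite setUCA.
    by rewrite disjoint_sym disjoint_setU1 fC disjoint_sym.
  by rewrite !inE eq_sym (negPf fe) -in_setU.
apply: contraT => nYC.
have : paintable (circuits M) A D (f |: C) e.
  apply: contraR nYC => nXC.
  have := IH (f |: C) D; rewrite disjoint_setU1 fD dCD -setUA => /(_ isT).
  rewrite in_setU1 eq_sym (negPf fe) eCD => /(_ isT ltf nXC).
  by apply: paintable_mono; rewrite ?subsetUr.
case/paintableP=> X [XM eX dX nXf].
have [g /orP[]/andP[gX gY]] := orthogonal_opposite XM YM eX eY.
  have := nY g gY; rewrite in_setU1 => /predU1P[gf|gD]; last first.
    by have := dX g (pos_supp gX); rewrite gD.
  case/negP: nX; apply/paintableP; exists X; split=> // h hX.
  have := nXf h hX; rewrite in_setU1 => /predU1P[hf|//].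
  by have := pos_neg (circuit_disjoint XM) gX; rewrite gf -hf hX.
have := nXf g gX; rewrite in_setU1 => /predU1P[gf|gC]; last first.
  by have := dY g (pos_supp gY); rewrite gC.
case/negP: nYC; apply/paintableP; exists Y; split=> // h hY.
have := nY h hY; rewrite in_setU1 => /predU1P[hf|//].
by have := pos_neg (cocircuit_disjoint YM) gY; rewrite gf -hf hY.
Qed.

(** Deletion is the dual of contraction. *)
Lemma paintable_delete A A' w C D e :
  (forall h, (h \in A') = (h \in A) (+) (h == w)) ->
  [disjoint C & D] -> w \notin C :|: D -> e \notin w |: (C :|: D) ->
  paintable (circuits M) A (w |: D) C e =
  paintable (circuits M) A D C e && paintable (circuits M) A' D C e.
Proof.
move=> flip dCD wCD ewCD; have [ew eCD] : e != w /\ e \notin C :|: D.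
  by apply/andP; rewrite -negb_or -in_setU1.
have wC : w \notin C by apply: contra wCD; rewrite inE => ->.
rewrite !painting //; first last.
- by rewrite setUCA.
- by rewrite disjoint_sym disjoint_setU1 wC disjoint_sym.
rewrite (paintable_contract flip (@cocircuit_disjoint)) ?negb_or //.
  by rewrite setUC.
by rewrite (setUC D).
Qed.

(** If reversing the sign of [w] changes the answer for [e], then the circuit
    behind the first answer and the cocircuit behind the second one contain [w],
    so that they answer the same question for [w]. *)
Lemma paintable_flip A A' w C D e :
  (forall h, (h \in A') = (h \in A) (+) (h == w)) ->
  [disjoint C & D] -> w \notin C :|: D -> e \notin C :|: D -> e != w ->
  paintable (circuits M) A D C e -> ~~ paintable (circuits M) A' D C e ->
  paintable (circuits M) A D C w /\ ~~ paintable (circuits M) A' D C w.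
Proof.
move=> flip dCD wCD eCD ew eA eA'.
have [wC wD] : w \notin C /\ w \notin D.
  by apply/andP; rewrite -negb_or -in_setU.
split; first exact: paintable_flip_pos flip _ _ _ _ _ _ _ eA'.
move: eA eA'; rewrite !painting // negbK => eA eA'.
by rewrite negbK; apply: paintable_flip_pos (flipC flip) _ _ _ _ _ _ _ eA.
Qed.

End Painting.

Import Order.TTheory GRing.Theory.

(** * Activities of minors *)

Section Activities.
Variables (d : Order.disp_t) (E : finOrderType d) (M : oriented_matroid E).
Implicit Types (A B C D : {set E}) (e f g h w : E) (t : bool).
Local Notation N := (underlying M).

Definition below D C e : {set E} := [set g in ~: (C :|: D) | (g < e)%O].

(** Asking for a circuit or cocircuit whose smallest element is [e] amounts to
    deleting, respectively contracting, the smaller elements of the minor first;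
    this is the case [t = true], respectively [t = false]. *)
Definition query_del D C t e := D :|: (if t then below D C e else set0).
Definition query_con D C t e := C :|: (if t then set0 else below D C e).

(** With [t = true], [e] is active in the minor. With [t = false], the painting
    theorem makes this the negation of [e] being dually active in the minor. *)
Definition answer A D C t e : bool :=
  paintable (circuits M) A (query_del D C t e) (query_con D C t e) e.

Lemma query_disjoint D C t e : [disjoint C & D] ->
  [disjoint query_con D C t e & query_del D C t e].
Proof.
rewrite !disjoints_subset => /subsetP dCD; apply/subsetP => h.
rewrite /query_con /query_del /below.
by case: t; rewrite !inE ?orbF ?negb_or; have := dCD h; rewrite inE;
  case: (h \in C) => [/(_ isT)->|_] //=; case: (h \in D).
Qed.

Lemma query_avoid D C t e h : h \notin C :|: D -> ~~ (h < e)%O ->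
  h \notin query_con D C t e :|: query_del D C t e.
Proof.
rewrite /query_con /query_del /below !inE !negb_or => /andP[hC hD] /negPf he.
by case: t; rewrite !inE ?hC ?hD he ?andbF.
Qed.

(** The queries with [t = true], for decreasing [e], followed by those with
    [t = false], for increasing [e], delete less and less and contract more and
    more. *)
Lemma query_chain D C t1 e1 t2 e2 :
  (query_del D C t2 e2 \subset query_del D C t1 e1) &&
  (query_con D C t1 e1 \subset query_con D C t2 e2) ||
  (query_del D C t1 e1 \subset query_del D C t2 e2) &&
  (query_con D C t2 e2 \subset query_con D C t1 e1).
Proof.
have mono a b : (a <= b)%O -> below D C a \subset below D C b.
  by move=> ab; apply/subsetP => h; rewrite !inE => /andP[-> /lt_le_trans->].
have mono0 a b : (a <= b)%O ->
    forall B, B :|: below D C a \subset B :|: below D C b.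
  by move=> ab B; apply/setUS/mono.
rewrite /query_con /query_del.
by case: t1; case: t2; rewrite ?setU0 ?subsetUl ?subxx ?andbT ?orbT //=;
  case/orP: (le_total e1 e2) => /mono0 ->; rewrite ?orbT.
Qed.

Lemma rest_delete C D w : ~: (C :|: (w |: D)) = ~: (C :|: D) :\ w.
Proof. by rewrite setUCA setCU setIC setDE. Qed.

Lemma rest_contract C D w : ~: ((w |: C) :|: D) = ~: (C :|: D) :\ w.
Proof. by rewrite -setUA setCU setIC setDE. Qed.

Lemma flipU1 A w : w \notin A -> forall h, (h \in w |: A) = (h \in A) (+) (h == w).
Proof.
by move=> wA h; rewrite in_setU1; have [->|_] := eqVneq h w;
  rewrite ?(negPf wA) ?addbF.
Qed.

Section TopElement.
Variables (C D : {set E}) (w : E).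
Hypotheses (dCD : [disjoint C & D]) (wR : w \in ~: (C :|: D)).
Hypothesis wmax : forall h, h \in ~: (C :|: D) -> (h <= w)%O.

Let wCD : w \notin C :|: D. Proof. by rewrite -in_setC. Qed.

Lemma below_top : below D C w = ~: (C :|: D) :\ w.
Proof.
apply/setP => h; rewrite inE in_setD1 andbC; have [hR|] := boolP (h \in _).
  by rewrite lt_neqAle wmax // andbT.
by rewrite !andbF.
Qed.

Lemma answer_loop A : answer A D C true w = spans N C w.
Proof.
rewrite -(paintable_spans M A); last by apply: contra wCD; rewrite inE => ->.
rewrite /answer /query_del /query_con below_top setU0; congr paintable.
apply/setP => h; rewrite !inE !negb_or.
have [->|_] := eqVneq h w.
  by apply: contraNF wCD; rewrite inE orbF orbC => ->.
case hC : (h \in C) => /=; last by case: (h \in D).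
by rewrite orbF (disjointFr dCD).
Qed.

Lemma answer_coloop A : answer A D C false w = spans N (~: (w |: D)) w.
Proof.
have wS : w \notin ~: (w |: D) by rewrite !inE eqxx.
rewrite -(paintable_spans M A wS) /answer /query_del /query_con below_top setU0.
congr paintable; apply/setP => h; rewrite !inE !negb_or ?negbK.
  have [->|_] /= := eqVneq h w; last by rewrite negbK.
  by apply/negbTE; apply: contra wCD; rewrite inE orbC => ->.
have [->|_] := eqVneq h w; first by apply: contraNF wCD; rewrite inE orbF => ->.
case hC : (h \in C) => //=.
by rewrite (disjointFr dCD).
Qed.

Variables A A' : {set E}.
Hypothesis flip : forall h, (h \in A') = (h \in A) (+) (h == w).

Section Other.
Variables (t : bool) (e : E).
Hypothesis eR : e \in ~: (C :|: D) :\ w.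

Let ew : e != w. Proof. by case/setD1P: eR. Qed.
Let eCD : e \notin C :|: D. Proof. by case/setD1P: eR; rewrite inE. Qed.
Let we : ~~ (w < e)%O. Proof. by rewrite -leNgt wmax // inE. Qed.
Let eQ := query_avoid t eCD (negbT (ltxx e)).
Let wQ := query_avoid t wCD we.

Lemma below_contract : below D (w |: C) e = below D C e.
Proof.
apply/setP => h; rewrite !inE; have [->|//] := eqVneq h w.
by rewrite (negPf we) !andbF.
Qed.

Lemma below_delete : below (w |: D) C e = below D C e.
Proof.
apply/setP => h; rewrite !inE orbCA; have [->|//] := eqVneq h w.
by rewrite (negPf we) !andbF.
Qed.

Lemma answer_contract :
  answer A D (w |: C) t e = answer A D C t e || answer A' D C t e.
Proof.
rewrite /answer -(paintable_contract flip (@circuit_disjoint _ M)) //; last first.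
  by rewrite in_setU1 negb_or ew eQ.
by rewrite /query_con /query_del below_contract setUA.
Qed.

Lemma answer_delete :
  answer A (w |: D) C t e = answer A D C t e && answer A' D C t e.
Proof.
rewrite /answer -(paintable_delete M flip) ?query_disjoint //; last first.
  by rewrite in_setU1 negb_or ew eQ.
by rewrite /query_con /query_del below_delete setUA.
Qed.

Lemma answer_flip : answer A D C t e -> ~~ answer A' D C t e ->
  paintable (circuits M) A (query_del D C t e) (query_con D C t e) w /\
  ~~ paintable (circuits M) A' (query_del D C t e) (query_con D C t e) w.
Proof. by apply: paintable_flip; rewrite ?query_disjoint. Qed.

End Other.

End TopElement.

Section Top.
Variables (C D : {set E}) (w : E).
Hypotheses (dCD : [disjoint C & D]) (wR : w \in ~: (C :|: D)).
Hypothesis wmax : forall h, h \in ~: (C :|: D) -> (h <= w)%O.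
Variables A A' : {set E}.
Hypothesis flip : forall h, (h \in A') = (h \in A) (+) (h == w).

(** Two elements whose answers change in opposite ways would have queries that
    order the two answers for [w] in opposite ways; but queries form a chain. *)
Lemma answers_comparable :
  (forall t e, e \in ~: (C :|: D) :\ w -> answer A D C t e -> answer A' D C t e) \/
  (forall t e, e \in ~: (C :|: D) :\ w -> answer A' D C t e -> answer A D C t e).
Proof.
have [/forallP AA'|] := boolP [forall q : bool * E,
    (q.2 \in ~: (C :|: D) :\ w) ==>
    (answer A D C q.1 q.2 ==> answer A' D C q.1 q.2)].
  by left=> t e eR eA; move: (AA' (t, e)); rewrite eR eA.
rewrite negb_forall => /existsP[[t1 e1]] /=.
rewrite 2!negb_imply => /and3P[e1R yes1 no1]; right=> t2 e2 e2R yes2.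
apply: contraT => no2.
have [y1 n1] := answer_flip dCD wR wmax flip e1R yes1 no1.
have [y2 n2] := answer_flip dCD wR wmax (flipC flip) e2R yes2 no2.
case/orP: (query_chain D C t1 e1 t2 e2) => /andP[sD sC].
  by case/negP: n2; apply: paintable_mono sD sC y1.
by case/negP: n1; apply: paintable_mono sD sC y2.
Qed.

(** If [w] is a loop, the answer for [w] is yes in the first query of the chain and
    so in all of them; if [w] is a coloop, it is no in the last one and so in all of
    them. A flip of [w] that changes an answer changes such an answer for [w]. *)
Lemma answer_const t e : spans N C w || ~~ spans N (~: (w |: D)) w ->
  e \in ~: (C :|: D) :\ w -> answer A D C t e = answer A' D C t e.
Proof.
move=> loop eR; have ltew : (e <= w)%O by rewrite wmax //; case/setD1P: eR.
have sbelow : below D C e \subset below D C w.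
  by apply/subsetP => h; rewrite !inE => /andP[-> /lt_le_trans->].
have noflip B B' : (forall h, (h \in B') = (h \in B) (+) (h == w)) ->
    answer B D C t e -> answer B' D C t e.
  move=> BB' yes; apply: contraT => no.
  have [y n] := answer_flip dCD wR wmax BB' eR yes no.
  case/orP: loop => [loop|/negP[]].
    case/negP: n; move: loop; rewrite -(answer_loop dCD wR wmax B').
    apply: paintable_mono; rewrite /query_del /query_con.
      by case: (t); rewrite setUS ?sub0set.
    by rewrite setUS ?sub0set.
  rewrite -(answer_coloop dCD wR wmax B); move: y.
  apply: paintable_mono; rewrite /query_del /query_con.
    by rewrite setUS ?sub0set.
  by case: (t); rewrite setUS ?sub0set.
by apply/idP/idP; apply: noflip => //; apply: flipC.
Qed.

End Top.

(** * The two recursions *)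

Section Recursion.
Variables (K : comNzRingType) (x u y v : K).

(** The dual activity is a negative answer, whence the order of the branches of the
    second factor. *)
Definition activity_weight A D C e : K :=
  (if answer A D C true e then if e \in A then v else y else 1) *
  (if answer A D C false e then 1 else if e \in A then u else x).

Definition activity_term A D C : K :=
  \prod_(e in ~: (C :|: D)) activity_weight A D C e.

Definition activity_sum D C : K :=
  \sum_(A : {set E} | A \subset ~: (C :|: D)) activity_term A D C.

(** The terms of the Tutte polynomial of the minor, at [x + u] and [y + v]: the rank
    of [A] in the minor is [mrank N (A :|: C) - mrank N C]. *)
Definition rank_term A D C : K :=
  (x + u - 1) ^+ (mrank N (~: D) - mrank N (A :|: C)) *
  (y + v - 1) ^+ (#|A| + mrank N C - mrank N (A :|: C)).

Definition rank_sum D C : K :=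
  \sum_(A : {set E} | A \subset ~: (C :|: D)) rank_term A D C.

Lemma sum_subsets_setD1 (R : {set E}) w (f : {set E} -> K) : w \in R ->
  \sum_(A : {set E} | A \subset R) f A =
  \sum_(A : {set E} | A \subset R :\ w) (f A + f (w |: A)).
Proof.
move=> wR; rewrite (bigID (fun A : {set E} => w \in A)) /= addrC big_split /=.
congr (_ + _); first by apply: eq_bigl => A; rewrite subsetD1.
rewrite (reindex_onto (fun A => w |: A) (fun A => A :\ w)) /=; last first.
  by move=> A /andP[_ wA]; rewrite setD1K.
apply: eq_bigl => A; rewrite subUset sub1set wR setU11 andbT subsetD1.
congr (_ && _); apply/eqP/idP => [<-|wA]; first by rewrite setD11.
by rewrite setU1K.
Qed.

Section Step.
Variables (C D : {set E}) (w : E).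
Hypotheses (dCD : [disjoint C & D]) (wR : w \in ~: (C :|: D)).
Hypothesis wmax : forall h, h \in ~: (C :|: D) -> (h <= w)%O.
Variable A : {set E}.
Hypothesis AR : A \subset ~: (C :|: D) :\ w.

Let wA : w \notin A. Proof. by apply/negP => /(subsetP AR); rewrite setD11. Qed.
Let wC : w \notin C. Proof. by move: wR; rewrite !inE negb_or => /andP[]. Qed.
Let wD : w \notin D. Proof. by move: wR; rewrite !inE negb_or => /andP[]. Qed.
Let flip := flipU1 wA.

Let restD := rest_delete C D w.
Let restC := rest_contract C D w.

Let mem_flip e : e \in ~: (C :|: D) :\ w -> (e \in w |: A) = (e \in A).
Proof. by move=> /setD1P[/negPf ew _]; rewrite in_setU1 ew. Qed.

Definition activity_prod B :=
  \prod_(e in ~: (C :|: D) :\ w) activity_weight B D C e.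

Lemma activity_term_top B :
  activity_term B D C = activity_weight B D C w * activity_prod B.
Proof. by rewrite /activity_term (big_setD1 w). Qed.

Lemma activity_weight_loop B : spans N C w ->
  activity_weight B D C w = if w \in B then v else y.
Proof.
move=> sp; rewrite /activity_weight (answer_loop dCD wR wmax) sp.
rewrite (answer_coloop dCD wR wmax) (spans_sub _ sp) ?mulr1 //.
rewrite subsetC subUset sub1set inE wC -disjoints_subset.
by rewrite disjoint_sym.
Qed.

Lemma activity_weight_coloop B : ~~ spans N (~: (w |: D)) w ->
  activity_weight B D C w = if w \in B then u else x.
Proof.
move=> nsp; rewrite /activity_weight (answer_coloop dCD wR wmax) (negPf nsp).
rewrite (answer_loop dCD wR wmax) ifN ?mul1r //; apply: contra nsp.
apply: spans_sub; rewrite subsetC subUset sub1set inE wC -disjoints_subset.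
by rewrite disjoint_sym.
Qed.

Lemma activity_term_eq B D' C' : ~: (C' :|: D') = ~: (C :|: D) :\ w ->
  (B \in [set A; w |: A]) ->
  (forall t e, e \in ~: (C :|: D) :\ w -> answer A D' C' t e = answer B D C t e) ->
  activity_term A D' C' = activity_prod B.
Proof.
move=> R' BA ans; rewrite /activity_term R'; apply: eq_bigr => e eR.
rewrite /activity_weight !ans //.
suff -> : (e \in B) = (e \in A) by [].
by move: BA; rewrite !inE => /pred2P[]->; rewrite ?mem_flip.
Qed.

(** A loop is active whatever its sign, and its sign affects no other element. *)
Lemma activity_step_loop : spans N C w ->
  activity_term A D C + activity_term (w |: A) D C =
  (y + v) * activity_term A (w |: D) C.
Proof.
move=> sp; have lc : spans N C w || ~~ spans N (~: (w |: D)) w by rewrite sp.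
rewrite !activity_term_top !activity_weight_loop // (negPf wA) setU11 mulrDl.
by congr (_ * _ + _ * _); apply/esym/activity_term_eq; rewrite ?inE ?eqxx ?orbT //;
  move=> t e eR; rewrite (answer_delete dCD wR wmax flip) //
    -(answer_const dCD wR wmax flip t lc eR) andbb.
Qed.

Lemma activity_step_coloop : ~~ spans N (~: (w |: D)) w ->
  activity_term A D C + activity_term (w |: A) D C =
  (x + u) * activity_term A D (w |: C).
Proof.
move=> sp; have lc : spans N C w || ~~ spans N (~: (w |: D)) w by rewrite sp orbT.
rewrite !activity_term_top !activity_weight_coloop // (negPf wA) setU11 mulrDl.
by congr (_ * _ + _ * _); apply/esym/activity_term_eq; rewrite ?inE ?eqxx ?orbT //;
  move=> t e eR; rewrite (answer_contract wR wmax flip) //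
    -(answer_const dCD wR wmax flip t lc eR) orbb.
Qed.

(** Deletion of [w] takes the conjunction, and contraction the disjunction, of the
    answers for [A] and [w |: A]. Since these are comparable, one of the two sets
    gives the activities of the deletion and the other those of the contraction. *)
Lemma activity_step_other : ~~ spans N C w -> spans N (~: (w |: D)) w ->
  activity_term A D C + activity_term (w |: A) D C =
  activity_term A (w |: D) C + activity_term A D (w |: C).
Proof.
move=> nsp sp; have w1 B : activity_weight B D C w = 1.
  by rewrite /activity_weight (answer_loop dCD wR wmax)
    (answer_coloop dCD wR wmax) sp (negPf nsp) mulr1.
rewrite !activity_term_top !w1 !mul1r.
case: (answers_comparable dCD wR wmax flip) => imp; [|rewrite addrC];
  congr (_ + _); apply/esym/activity_term_eq; rewrite ?inE ?eqxx ?orbT //;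
  move=> t e eR; rewrite ?(answer_delete dCD wR wmax flip) //
    ?(answer_contract wR wmax flip) //; have := imp t e eR;
  by case: (answer A D C t e); case: (answer (w |: A) D C t e) => // /(_ isT).
Qed.

Lemma rank_delete :
  mrank N (~: D) = (mrank N (~: (w |: D)) + ~~ spans N (~: (w |: D)) w)%N.
Proof.
rewrite -rankU1; last by rewrite !inE eqxx.
by rewrite setCU setIC -setDE setD1K // inE.
Qed.

Let sACD : A :|: C \subset ~: (w |: D).
Proof.
rewrite subsetC subUset sub1set !inE negb_or wA wC /=.
rewrite setCU subsetI -!disjoints_subset.
rewrite disjoint_sym [X in _ && X]disjoint_sym dCD andbT.
rewrite disjoints_subset; apply: subset_trans AR _.
by apply/subsetP => h; rewrite !inE negb_or => /and3P[].
Qed.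

Let wAC : w \notin A :|: C. Proof. by rewrite inE negb_or wA. Qed.

Let rank_step := (rank_delete, rankU1 N wC, rankU1 N wAC, cardsU1, wA).

Lemma rank_step_loop : spans N C w ->
  rank_term A D C + rank_term (w |: A) D C = (y + v) * rank_term A (w |: D) C.
Proof.
move=> sp; have spAC := spans_sub (subsetUr A C) sp.
rewrite /rank_term -setUA !rank_step spAC (spans_sub sACD spAC) !addn0 add1n.
rewrite addSn subSn ?rank_subadd // exprS.
by move: (_ ^+ _) (_ ^+ _) => a b; ring.
Qed.

Lemma rank_step_coloop : ~~ spans N (~: (w |: D)) w ->
  rank_term A D C + rank_term (w |: A) D C = (x + u) * rank_term A D (w |: C).
Proof.
move=> nsp; have nspAC := contra (spans_sub sACD) nsp.
have nspC := contra (spans_sub (subsetUr A C)) nspAC.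
rewrite /rank_term (setUCA A) -setUA !rank_step nsp nspAC nspC /=.
rewrite add1n !addn1 addSn addnS !subSS subSn ?rank_mono // exprS.
by move: (_ ^+ _) (_ ^+ _) => a b; ring.
Qed.

Lemma rank_step_other : ~~ spans N C w -> spans N (~: (w |: D)) w ->
  rank_term A D C + rank_term (w |: A) D C =
  rank_term A (w |: D) C + rank_term A D (w |: C).
Proof.
move=> nspC sp; rewrite /rank_term (setUCA A) -setUA !rank_step sp nspC /=.
by rewrite add1n addn0 addn1 addSn addnS.
Qed.

End Step.

(** Both sums obey the same recursion over the largest remaining element. *)
Lemma rank_sum_activity D C : [disjoint C & D] -> rank_sum D C = activity_sum D C.
Proof.
have [n] := ubnP #|~: (C :|: D)|; elim: n C D => // n IH C D /ltnSE le dCD.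
have [R0|[w0 w0R]] := set_0Vmem (~: (C :|: D)).
  have DC : ~: D = C.
    apply/setP => h; have := in_set0 h; rewrite -R0 !inE negb_or.
    by case hC : (h \in C); [rewrite (disjointFr dCD) | case: (h \in D)].
  rewrite /rank_sum /activity_sum R0; apply: eq_bigr => A.
  rewrite subset0 => /eqP ->; rewrite /activity_term R0 big_set0 /rank_term.
  by rewrite DC set0U cards0 !subnn mulr1.
have [w wR wmax] : exists2 w, w \in ~: (C :|: D) &
    forall h, h \in ~: (C :|: D) -> (h <= w)%O.
  by case: (@arg_maxP _ _ _ w0 (mem (~: (C :|: D))) id w0R) => w wR wmax; exists w.
have [wC wD] : w \notin C /\ w \notin D.
  by apply/andP; rewrite -negb_or -in_setU -in_setC.
have ltR : (#|~: (C :|: D) :\ w| < n)%N by rewrite (cardsD1 w) wR in le.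
have del : rank_sum (w |: D) C = activity_sum (w |: D) C.
  apply: IH; rewrite ?rest_delete //.
  by rewrite disjoint_sym disjoint_setU1 wC disjoint_sym.
have con : rank_sum D (w |: C) = activity_sum D (w |: C).
  by apply: IH; rewrite ?rest_contract ?disjoint_setU1 ?wD.
rewrite /rank_sum /activity_sum rest_delete rest_contract in del con *.
rewrite !(sum_subsets_setD1 _ wR).
have [sp|nspC] := boolP (spans N C w).
  rewrite (eq_bigr _ (fun A AR => rank_step_loop dCD wR AR sp)).
  rewrite (eq_bigr _ (fun A AR => activity_step_loop dCD wR wmax AR sp)).
  by rewrite -!mulr_sumr del.
have [sp|nsp] := boolP (spans N (~: (w |: D)) w).
  rewrite (eq_bigr _ (fun A AR => rank_step_other wR AR nspC sp)).
  rewrite (eq_bigr _ (fun A AR => activity_step_other dCD wR wmax AR nspC sp)).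
  by rewrite !big_split /= del con.
rewrite (eq_bigr _ (fun A AR => rank_step_coloop dCD wR AR nsp)).
rewrite (eq_bigr _ (fun A AR => activity_step_coloop dCD wR wmax AR nsp)).
by rewrite -!mulr_sumr con.
Qed.

End Recursion.

(** * Positive circuits and cocircuits of reorientations *)

Lemma smallest_positive_paintable A (F F' : {set signed_set E}) e :
  (forall X, (X \in F') = (reorient_set A X \in F)) ->
  [exists X in F', spositive X && smallest (supp X) e] =
  paintable F A (below set0 set0 e) set0 e.
Proof.
move=> FF'; apply/exists_inP/paintableP => [[X XF]|[X [XF eX dX nX]]].
  case/andP=> /eqP X2 /andP[eX /forall_inP minX]; exists (reorient_set A X).
  rewrite -FF' posE reorient_setK; split=> //.
  - by move: eX; rewrite inE X2 inE orbF.
  - by move=> f; rewrite supp_reorient => /minX ef; rewrite inE ltNge ef andbF.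
  by move=> f; rewrite negE reorient_setK X2.
exists (reorient_set A X); first by rewrite FF' reorient_setK.
apply/andP; split.
  by apply/eqP/setP => f; rewrite -negE in_set0; apply/negP => /nX; rewrite inE.
rewrite /smallest supp_reorient (pos_supp eX); apply/forall_inP => f /dX.
by rewrite !inE -leNgt.
Qed.

Lemma sorthogonal_reorient A X Y :
  sorthogonal (reorient_set A X) (reorient_set A Y) = sorthogonal X Y.
Proof.
rewrite /sorthogonal !supp_reorient; congr (_ || _).
by congr andb; congr (~~ (_ == _));
  apply/setP => f; rewrite !inE; case: (f \in A);
  rewrite ?andbT ?andbF ?orbF //= orbC.
Qed.

Lemma eq_mcocircuit (N1 N2 : matroid E) : mcircuits N1 = mcircuits N2 ->
  mcocircuit N1 =1 mcocircuit N2.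
Proof.
move=> eqN W; have eqI I : independent N1 I = independent N2 I.
  by rewrite /independent eqN.
have eqr T : mrank N1 T = mrank N2 T.
  by apply: eq_bigl => I; rewrite eqI.
by apply/mcocircuitP/mcocircuitP; rewrite !eqr => -[? h]; split=> // e;
  have := h e; rewrite !eqr.
Qed.

Lemma cocircuits_reorient A Y :
  (Y \in cocircuits (reorient A M)) = (reorient_set A Y \in cocircuits M).
Proof.
rewrite !inE supp_reorient; congr [&& _, _ & _].
- rewrite -!setI_eq0; congr (_ == _); apply/setP => f; rewrite !inE.
  by case: (f \in A); rewrite ?andbT ?andbF ?orbF //= andbC.
- apply: eq_mcocircuit; apply/setP => W; apply/imsetP/imsetP => -[X XM ->].
    by move: XM; rewrite mem_reorient => XM; exists (reorient_set A X);
      rewrite ?supp_reorient.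
  by exists (reorient_set A X); rewrite ?supp_reorient // mem_reorient reorient_setK.
apply/forall_inP/forall_inP => oY X XM.
  rewrite -(reorient_setK A X) sorthogonal_reorient; apply: oY.
  by rewrite mem_reorient reorient_setK.
by rewrite -(sorthogonal_reorient A); apply: oY; rewrite -mem_reorient.
Qed.

Lemma mem_active A e :
  (e \in active (reorient A M)) = answer A set0 set0 true e.
Proof.
rewrite inE (@smallest_positive_paintable A (circuits M)) //;
  last exact: mem_reorient.
by rewrite /answer /query_del /query_con setU0 set0U.
Qed.

Lemma mem_dual_active A e :
  (e \in dual_active (reorient A M)) = ~~ answer A set0 set0 false e.
Proof.
rewrite inE (@smallest_positive_paintable A (cocircuits M));
  last exact: cocircuits_reorient.
rewrite /answer painting ?query_disjoint //; last first.
- by rewrite query_avoid ?ltxx // !inE.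
- by rewrite -setI_eq0 set0I.
by rewrite negbK /query_del /query_con setU0 set0U.
Qed.

End Activities.

Lemma prod_if_in (E : finType) (K : comNzRingType) (a b : K) (O A : {set E}) :
  \prod_e (if e \in O then if e \in A then b else a else 1) =
  a ^+ #|O :\: A| * b ^+ #|O :&: A|.
Proof.
rewrite -big_mkcond /= (bigID (mem A)) /= mulrC.
rewrite -!prodr_const; congr (_ * _).
  rewrite (eq_bigl (mem (O :\: A))) => [|e]; last by rewrite !inE andbC.
  by apply: eq_bigr => e /setDP[_ /negPf->].
rewrite (eq_bigl (mem (O :&: A))) => [|e]; last by rewrite !inE.
by apply: eq_bigr => e /setIP[_ ->].
Qed.

Lemma activity_termE (d : Order.disp_t) (E : finOrderType d)
    (M : oriented_matroid E) (K : comNzRingType) (x u y v : K) (A : {set E}) :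
  activity_term M x u y v A set0 set0 =
  x ^+ theta_star M A * u ^+ theta_bar_star M A
  * y ^+ theta M A * v ^+ theta_bar M A.
Proof.
rewrite -mulrA -!prod_if_in -big_split /= /activity_term setU0 setC0.
apply: eq_big => [e|e _]; first by rewrite inE.
by rewrite /activity_weight mulrC mem_active mem_dual_active if_neg.
Qed.

Theorem theorem2p1 (d : Order.disp_t) (E : finOrderType d)
    (M : oriented_matroid E) :
  let x : {mpoly int[4]} := 'X_(@Ordinal 4 0 isT) in
  let u : {mpoly int[4]} := 'X_(@Ordinal 4 1 isT) in
  let y : {mpoly int[4]} := 'X_(@Ordinal 4 2 isT) in
  let v : {mpoly int[4]} := 'X_(@Ordinal 4 3 isT) in
  tutte (underlying M) \mPo [tuple x + u; y + v] =
  \sum_(A : {set E})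
    x ^+ theta_star M A * u ^+ theta_bar_star M A
    * y ^+ theta M A * v ^+ theta_bar M A.
Proof.
move=> x u y v.
under [RHS]eq_bigr do rewrite -activity_termE.
have subT (A : {set E}) : (A \subset ~: (set0 :|: set0)) = true.
  by rewrite setU0 setC0 subsetT.
have := @rank_sum_activity _ E M _ x u y v set0 set0.
rewrite -setI_eq0 set0I eqxx /rank_sum /activity_sum => /(_ isT).
rewrite !(eq_bigl _ _ subT) => <-.
rewrite /tutte rmorph_sum; apply: eq_bigr => A _.
by rewrite /rank_term rmorphM !rmorphXn !rmorphB !rmorph1 /= !comp_mpolyXU
  setC0 setU0 rank0 addn0.
Qed.
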